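(* Let $d\geq 1$, let $\gamma\in(-\infty,d]$, let $\beta=2^{\gamma-d}$, and let $T$ be the random tree with node probability $\beta$ and $\tau\subset[0,1]^d$ the associated random set, both as defined in the context. If $\gamma\in(-\infty,0]$, then $\tau=\emptyset$ with probability one. If $\gamma\in(0,d]$, then $\tau$ has Hausdorff dimension $\dim_H(\tau)=\gamma$ with probability $1-P_\beta$ and $\tau$ is empty with probability $P_\beta$, where $P_\beta$ is the solution in $[0,1)$ of $$P_\beta=\big((1-\beta)+\beta P_\beta\big)^{2^d}.$$
   Context: Random tree $T$. Nodes are pairs $(j,k)$ with $j\in\{0,1,2,\dots\}$ and $k=(k_1,\dots,k_d)\in\mathbb{Z}^d$. For $k\in\mathbb{Z}^d$ write $[k/2]=([k_1/2],\dots,[k_d/2])$, where $[\cdot]$ is the integer part (floor); the parent of $(j,k)$, $j\geq1$, is $(j-1,[k/2])$. Let $t_{j,k}$ be independent random variables uniformly distributed on $[0,1]$. The random tree $T$ is built recursively: the root node $(0,0)$ always belongs to $T$ and is its only node at level $0$; once all nodes of $T$ at level $j$ have been determined, a node $(j+1,l)$ belongs to $T$ if and only if $(j,[l/2])\in T$ and $t_{j+1,l}<\beta$. (Thus each node of $T$ has $2^d$ potential children, each included independently with probability $\beta$, and all nodes of $T$ at level $j$ have $k\in\{0,\dots,2^j-1\}^d$.) Random set $\tau$. For $j\geq 0$ and $k\in\{0,\dots,2^j-1\}^d$ let $Q_{j,k}=\{y\in[0,1]^d : [2^jy]=k\}$ (componentwise integer part) be the dyadic cube, with closure $\overline{Q}_{j,k}$.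 Let $R_j=\{k:(j,k)\in T\}$ and $$\tau=\bigcap_{j=1}^\infty\ \bigcup_{k\in R_j}\overline{Q}_{j,k}.$$ *)

(* Defs.v *)
From HB Require Import structures.
From mathcomp Require Import all_boot all_order all_algebra.
From mathcomp Require Import all_classical all_reals all_analysis.

Set Implicit Arguments.
Unset Strict Implicit.
Unset Printing Implicit Defensive.

Import Order.TTheory GRing.Theory Num.Theory.
Import numFieldNormedType.Exports.

Local Open Scope classical_set_scope.
Local Open Scope ring_scope.

Section HausdorffDimension.
Context {R : realType} {d : nat}.
Implicit Types (A U : set 'rV[R]_d) (s delta : R).

(* The library norm on 'rV[R]_d is the sup norm; diameters are Euclidean. *)
Definition edist (x y : 'rV[R]_d) : R :=
  Num.sqrt (\sum_(i < d) (x 0 i - y 0 i) ^+ 2).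

(* -oo on the empty set *)
Definition diam U : \bar R :=
  ereal_sup [set e | exists x y, [/\ U x, U y & e = (edist x y)%:E]].

(* The empty set contributes 0 for every s, including s = 0; a singleton
   contributes 0 `^ 0 = 1 for s = 0, so that [hausdorff_measure 0] is the
   counting measure. *)
Definition diam_pow s U : \bar R :=
  if `[< U = set0 >] then 0%E else poweR (diam U) s.

Definition hausdorff_premeasure s delta A : \bar R :=
  ereal_inf [set c | exists U : nat -> set 'rV[R]_d,
    [/\ A `<=` \bigcup_n U n,
        forall n, (diam (U n) <= delta%:E)%E
      & c = (\sum_(0 <= n <oo) diam_pow s (U n))%E]].

Definition hausdorff_measure s A : \bar R :=
  ereal_sup [set hausdorff_premeasure s delta A | delta in [set e | 0 < e]].

Definition hausdorff_dim A : \bar R :=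
  ereal_inf [set s%:E | s in [set s | 0 <= s /\ hausdorff_measure s A = 0%E]].

End HausdorffDimension.

Section Probability.
Context {disp : measure_display} {Omega : measurableType disp} {R : realType}.
Variable P : probability Omega R.

(* mutual independence of an arbitrary (possibly infinite) family *)
Definition independent_RVs (I : choiceType) (X : I -> {RV P >-> R}) : Prop :=
  forall (s : seq I) (B : I -> set R), uniq s ->
    (forall i, measurable (B i)) ->
    P (\bigcap_(i in [set` s]) (X i @^-1` B i)) =
    (\prod_(i <- s) P (X i @^-1` B i))%E.

Definition uniform01 (X : {RV P >-> R}) : Prop :=
  forall A : set R, measurable A ->
    distribution P X A = uniform_prob (@ltr01 R) A.

(* [E] belongs to the completion of the sigma-algebra with respect to [P] and
   has probability [p] there; for measurable [E] this amounts to P E = p. *)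
Definition has_probability (E : set Omega) (p : R) : Prop :=
  exists A, [/\ measurable A, P A = p%:E & P.-negligible (E `+` A)].

End Probability.

Section RandomTree.
Context {R : realType} {d : nat}.

(* intdiv's quotient by 2 is the floor, also for negative entries. *)
Definition parent (k : 'rV[int]_d) : 'rV[int]_d :=
  map_mx (fun z => (z %/ 2)%Z) k.

Context {disp : measure_display} {Omega : measurableType disp}.
Context {P : probability Omega R}.
Variables (beta : R) (t : nat -> 'rV[int]_d -> {RV P >-> R}).

Fixpoint level (w : Omega) (j : nat) : set 'rV[int]_d :=
  if j is j'.+1 then [set l | level w j' (parent l) /\ t j'.+1 l w < beta]
  else [set 0].

Definition tree (w : Omega) : set (nat * 'rV[int]_d) :=
  [set n | level w n.1 n.2].

Definition cube (j : nat) (k : 'rV[int]_d) : set 'rV[R]_d :=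
  [set y : 'rV[R]_d | (forall i, 0 <= y 0 i <= 1) /\
           map_mx (fun u => Num.floor (2 ^+ j * u)) y = k].

Definition tau (w : Omega) : set 'rV[R]_d :=
  \bigcap_(j in [set j | (1 <= j)%N])
    \bigcup_(k in [set k | tree w (j, k)]) closure (cube j k).

End RandomTree.

(* Main.v *)
Require Import Defs.
From HB Require Import structures.
From mathcomp Require Import all_boot all_order all_algebra.
From mathcomp Require Import all_classical all_reals all_analysis.
From mathcomp Require Import ring lra zify.

Set Implicit Arguments.
Unset Strict Implicit.
Unset Printing Implicit Defensive.

Import Order.TTheory GRing.Theory Num.Theory.
Import numFieldNormedType.Exports.

Local Open Scope classical_set_scope.
Local Open Scope ring_scope.

(** Write [N = 2 ^ d].  The tree is a Galton-Watson tree whose offspring law is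
    binomial with parameters [N] and [beta], hence of mean
    [N * beta = 2 ^ gamma], and by compactness [tau] is empty exactly when the
    tree dies out ([tau_eq0]).

    Extinction.  The probability that the tree is dead at level [n] is the
    [n]-th iterate at 0 of the generating function
    [f q = (1 - beta + beta * q) ^ N] ([extinction_probE]).  The secant slope
    of [f] between [q] and 1 is strictly increasing in [q], equals the mean at
    [q = 1], and equals 1 exactly at the fixed points below 1.  So the iterates
    tend to 1 when [gamma <= 0], and for [gamma > 0] there is a unique fixed
    point [p] with [0 <= p < 1], which attracts every starting point [a] with
    [0 <= a < 1] ([cvg_iter_pgf]).

    Upper bound.  Level [n] has on average [2 ^ (gamma * n)] nodes.  For
    [s > gamma], covering [tau] by the cubes of level [n] shows that its
    [s]-dimensional Hausdorff measure vanishes almost surely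
    ([hausdorff_measure_tau_eq0_ae]).

    Lower bound.  Instead of constructing a random measure on [tau], the proof
    thins the tree, an idea of R. Lyons.  Fix [0 < s < gamma].  Lowering the
    threshold from [beta] to [beta * 2 ^ (- s)] amounts to keeping each node of
    the tree independently with probability [2 ^ (- s)].  If the
    [s]-dimensional measure of [tau] is zero, a cover of [tau] by sets of small
    diameters turns, by Konig's lemma, into cuts of the tree of arbitrarily
    small total weight, where a node of level [j] weighs [2 ^ (- s * j)]
    ([cut_cost_small_of_null]).  Given the tree, the thinned tree survives with
    probability at most the weight of any cut ([percolation_le_cut_cost]).
    Hence, almost surely, a surviving thinned tree excludes measure zero
    ([thinned_survival_null]).  The thinned tree is itself a supercritical
    Galton-Watson tree and so survives with positive probability.  To reach all
    of the survival event of the original tree, the thinning is started only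
    after level [m]: the mixed tree then dies with probability at most
    [f^m(p')], with [p' < 1] the extinction probability of the thinned tree,
    and this tends to [p] as [m] grows ([tau_positive_measure_ae]).

    All the probabilities above concern finitely many levels.  They are
    computed as finite sums over the type [conf] of configurations of these
    levels, which carries a product weight; [conf_event_probability] transfers
    the results to the given probability space. *)

(** * Fixed points of the binomial generating function *)

Section GaltonWatson.
Context {R : realType}.
Implicit Types (n m : nat) (b p q a : R).

(** The probability generating function of the binomial law. *)
Definition pgf n b q : R := ((1 - b) + b * q) ^+ n.

(** The secant slope of the generating function between [q] and 1, expanded
    as a geometric sum so that it also makes sense, and is continuous, at
    [q = 1].  Its monotonicity plays the role of convexity. *)
Definition pgf_slope n b q : R := b * \sum_(i < n) ((1 - b) + b * q) ^+ i.

Lemma pgf_slopeE n b q : 1 - pgf n b q = (1 - q) * pgf_slope n b q.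
Proof.
rewrite -opprB /pgf subrX1 /pgf_slope mulrA -mulNr; congr (_ * _); ring.
Qed.

Lemma pgf_slope_lt n b p q : (1 < n)%N -> 0 < b <= 1 -> 0 <= p < q ->
  pgf_slope n b p < pgf_slope n b q.
Proof.
case: n => [|[|n]]// _ /andP[b0 b1] /andP[p0 pq].
rewrite /pgf_slope ltr_pM2l// !big_ord_recl !expr0 ltrD2l.
apply: ltr_leD.
  by rewrite !expr1 ltrD2l ltr_pM2l.
apply: ler_sum => i _; apply: lerXn2r; rewrite ?nnegrE.
- by apply: addr_ge0; [lra|apply: mulr_ge0 => //; exact: ltW].
- by apply: addr_ge0; [lra|apply: mulr_ge0; lra].
- by rewrite lerD2l ler_pM2l// ltW.
Qed.

Lemma pgf_slope1 n b : pgf_slope n b 1 = b * n%:R.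
Proof.
rewrite /pgf_slope mulr1 subrK; congr (_ * _).
by under eq_bigr do rewrite expr1n; rewrite sumr_const card_ord.
Qed.

Lemma pgf_ge0 n b q : 0 <= b <= 1 -> 0 <= q -> 0 <= pgf n b q.
Proof.
by move=> /andP[b0 b1] q0; apply: exprn_ge0; apply: addr_ge0;
  [lra|exact: mulr_ge0].
Qed.

Lemma pgf_le n b p q : 0 <= b <= 1 -> 0 <= p <= q -> pgf n b p <= pgf n b q.
Proof.
move=> /andP[b0 b1] /andP[p0 pq]; apply: lerXn2r; rewrite ?nnegrE.
- by apply: addr_ge0; [lra|exact: mulr_ge0].
- by apply: addr_ge0; [lra|apply: mulr_ge0; lra].
- by rewrite lerD2l ler_wpM2l.
Qed.

Lemma pgf1 n b : pgf n b 1 = 1.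
Proof. by rewrite /pgf mulr1 subrK expr1n. Qed.

Lemma pgf_fixed_slope n b q : q < 1 -> pgf n b q = q -> pgf_slope n b q = 1.
Proof.
move=> q1 fq; have := pgf_slopeE n b q; rewrite fq => h.
have q1' : 1 - q != 0 by rewrite subr_eq0 gt_eqF.
by apply: (mulfI q1'); rewrite -h mulr1.
Qed.

Lemma pgf_fixed_uniq n b p q : (1 < n)%N -> 0 < b <= 1 ->
  0 <= p < 1 -> 0 <= q < 1 -> pgf n b p = p -> pgf n b q = q -> p = q.
Proof.
move=> n1 hb /andP[p0 p1] /andP[q0 q1] hp hq.
have sp := pgf_fixed_slope p1 hp; have sq := pgf_fixed_slope q1 hq.
apply/eqP; case: ltgtP => // pq.
- have := @pgf_slope_lt n b p q n1 hb; rewrite p0 pq sp sq ltxx => /(_ isT) //.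
- have := @pgf_slope_lt n b q p n1 hb; rewrite q0 pq sp sq ltxx => /(_ isT) //.
Qed.

Lemma pgf_continuous n b : continuous (pgf n b).
Proof.
have -> : pgf n b = horner (((1 - b)%:P + b *: 'X) ^+ n).
  by apply/funext => q; rewrite /pgf !hornerE.
exact: continuous_horner.
Qed.

Lemma pgf_slope_continuous n b : continuous (pgf_slope n b).
Proof.
have -> : pgf_slope n b =
    horner (b *: \sum_(i < n) ((1 - b)%:P + b *: 'X) ^+ i).
  apply/funext => q; rewrite /pgf_slope !hornerE horner_sum; congr (_ * _).
  by apply: eq_bigr => i _; rewrite !hornerE.
exact: continuous_horner.
Qed.

(** The secant slope is at most 1 at 0 and exceeds 1 at 1, so it takes the
    value 1 in between. *)
Lemma pgf_fixed_exists n b : 0 < b <= 1 -> 1 < b * n%:R ->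
  exists2 p, 0 <= p < 1 & pgf n b p = p.
Proof.
move=> /andP[b0 b1] bn.
have s0 : pgf_slope n b 0 <= 1.
  have := pgf_slopeE n b 0; rewrite subr0 mul1r => <-.
  by rewrite gerBl pgf_ge0 // b1 ltW.
have s1 : 1 < pgf_slope n b 1 by rewrite pgf_slope1.
have [] := @IVT R (pgf_slope n b) 0 1 1 ler01.
- exact/continuous_subspaceT/pgf_slope_continuous.
- by rewrite ge_min s0 le_max (ltW s1) orbT.
move=> p; rewrite in_itv/= => /andP[p0 p1] hp.
have p1' : p < 1.
  by rewrite lt_neqAle p1 andbT; apply: contraPneq hp => ->; move: s1; lra.
exists p; first by rewrite p0 p1'.
by have := pgf_slopeE n b p; rewrite hp; lra.
Qed.

Lemma cvg_seq_le (u : nat -> R) c l :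
  u m @[m --> \oo] --> l -> (forall m, u m <= c) -> l <= c.
Proof.
by move=> cl uc; rewrite -(cvg_lim _ cl)//; apply: limr_le;
  [exact: cvgP cl|exact: nearW].
Qed.

Lemma cvg_seq_ge (u : nat -> R) c l :
  u m @[m --> \oo] --> l -> (forall m, c <= u m) -> c <= l.
Proof.
by move=> cl uc; rewrite -(cvg_lim _ cl)//; apply: limr_ge;
  [exact: cvgP cl|exact: nearW].
Qed.

Lemma cvg_iter_fixed (f : R -> R) a l : continuous f ->
  iter m f a @[m --> \oo] --> l -> f l = l.
Proof.
move=> cf cl.
have c1 : iter m.+1 f a @[m --> \oo] --> f l.
  by apply: (@cvg_comp _ _ _ _ _ _ _ _ cl); exact: cf.
have c2 : iter m.+1 f a @[m --> \oo] --> l.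
  by move: cl; rewrite -(cvg_shiftS (fun m => iter m f a)).
exact: (cvg_unique _ c1 c2).
Qed.

Lemma iter_pgf_itv n b a m : 0 <= b <= 1 -> 0 <= a <= 1 ->
  0 <= iter m (pgf n b) a <= 1.
Proof.
move=> hb ha; elim: m => //= m /andP[h0 h1].
by rewrite pgf_ge0//= -[leRHS](pgf1 n b) pgf_le// h0 h1.
Qed.

(** The generating function is increasing, so its iterates are monotone, in
    the direction of the first step. *)
Lemma cvg_monotone_iter_pgf n b a : 0 <= b <= 1 -> 0 <= a <= 1 ->
  exists l, iter m (pgf n b) a @[m --> \oo] --> l /\
   ((a <= pgf n b a /\ forall m, iter m (pgf n b) a <= l) \/
   (pgf n b a <= a /\ forall m, l <= iter m (pgf n b) a)).
Proof.
move=> hb ha; have I := iter_pgf_itv n _ hb ha.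
have [h|h] := leP a (pgf n b a).
- have nd : nondecreasing_seq (fun m => iter m (pgf n b) a).
    apply/nondecreasing_seqP; elim => //= m IH.
    by apply: pgf_le => //; rewrite IH andbT; have /andP[] := I m.
  have c : cvgn (fun m => iter m (pgf n b) a).
    apply: nondecreasing_is_cvgn => //.
    by exists 1 => _ [m _ <-]; have /andP[] := I m.
  exists (limn (fun m => iter m (pgf n b) a)); split => //; left; split => //.
  by move=> m; exact: (nondecreasing_cvgn_le nd c).
- have nd : nonincreasing_seq (fun m => iter m (pgf n b) a).
    apply/nonincreasing_seqP; elim => [|m IH] /=; first exact: ltW.
    by apply: pgf_le => //; rewrite IH andbT; have /andP[] := I m.+1.
  have c : cvgn (fun m => iter m (pgf n b) a).
    apply: nonincreasing_is_cvgn => //.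
    by exists 0 => _ [m _ <-]; have /andP[] := I m.
  exists (limn (fun m => iter m (pgf n b) a)); split => //; right; split.
    exact: ltW.
  by move=> m; exact: (nonincreasing_cvgn_ge nd c).
Qed.

(** The limit of the iterates is a fixed point, so only a limit equal to 1
    has to be excluded.  Increasing iterates start below [p], since the
    slope exceeds 1 above [p], and then stay below [p]. *)
Lemma cvg_iter_pgf n b p a : (1 < n)%N -> 0 < b <= 1 ->
  0 <= p < 1 -> pgf n b p = p -> 0 <= a < 1 ->
  iter m (pgf n b) a @[m --> \oo] --> p.
Proof.
move=> n1 /[dup] hb /andP[b0 b1] hp fp /andP[a0 a1].
have hb' : 0 <= b <= 1 by rewrite b1 ltW.
have ha : 0 <= a <= 1 by rewrite a0 ltW.
have [l [cl hl]] := cvg_monotone_iter_pgf n hb' ha.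
have fl := cvg_iter_fixed (@pgf_continuous n b) cl.
have l0 : 0 <= l.
  by apply: (cvg_seq_ge cl) => m; have /andP[] := iter_pgf_itv n m hb' ha.
suff l1 : l < 1.
  by rewrite (@pgf_fixed_uniq n b p l)// l0 l1.
case: hl => -[fa hl]; last by apply: le_lt_trans a1; exact: (hl 0%N).
suff : l <= p by case/andP : hp; lra.
have ap : a <= p.
  case: leP => // pa.
  have : 1 < pgf_slope n b a.
    rewrite -(@pgf_fixed_slope n b p)//; last by case/andP : hp.
    by apply: pgf_slope_lt => //; rewrite pa andbT; case/andP: hp.
  have := pgf_slopeE n b a; have : 0 < 1 - a by lra.
  nra.
apply: (cvg_seq_le cl) => m; elim: m => //= k IH.
rewrite -fp; apply: pgf_le => //; rewrite IH andbT.
by have /andP[] := iter_pgf_itv n k hb' ha.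
Qed.

(** A limit [l < 1] would be a fixed point, where the secant slope is 1 but
    also smaller than the mean, hence smaller than 1. *)
Lemma cvg_iter_pgf_subcritical n b : (1 < n)%N -> 0 < b <= 1 ->
  b * n%:R <= 1 -> iter m (pgf n b) 0 @[m --> \oo] --> (1 : R).
Proof.
move=> n1 /[dup] hb /andP[b0 b1] bn.
have hb' : 0 <= b <= 1 by rewrite b1 ltW.
have h0 : 0 <= (0 : R) <= 1 by rewrite lexx ler01.
have [l [cl _]] := cvg_monotone_iter_pgf n hb' h0.
have fl := cvg_iter_fixed (@pgf_continuous n b) cl.
have l0 : 0 <= l.
  by apply: (cvg_seq_ge cl) => m; have /andP[] := iter_pgf_itv n m hb' h0.
have l1 : l <= 1.
  by apply: (cvg_seq_le cl) => m; have /andP[] := iter_pgf_itv n m hb' h0.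
suff <- : l = 1 by [].
apply/eqP; rewrite eq_le l1/= leNgt; apply/negP => l1'.
have := @pgf_slope_lt n b l 1 n1 hb; rewrite l0 l1' pgf_slope1.
by rewrite (pgf_fixed_slope l1' fl) => /(_ isT); move: bn; lra.
Qed.

End GaltonWatson.

(** * Configurations of finitely many levels of a tree *)

Section FiniteTrees.
Context {R : realType} {C : finType}.

(** The states of the nodes of levels 1 to [n].  The configuration in the
    subtree of a child is a component of the whole configuration, so that
    independence of the subtrees becomes distributivity of products over
    sums. *)
Fixpoint conf (K : finType) n : finType :=
  if n is n'.+1 then {ffun C -> K * conf K n'} else unit.

Lemma sum_ffun_marginal (X : finType) (F : C -> X -> R) (H : X -> R) c0 :
  \sum_(g : {ffun C -> X}) (\prod_c F c (g c)) * H (g c0) =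
  (\sum_x F c0 x * H x) * \prod_(c | c != c0) \sum_x F c x.
Proof.
pose F' c x := if c == c0 then F c x * H x else F c x.
rewrite [LHS](_ : _ = \sum_(g : {ffun C -> X}) \prod_c F' c (g c)); last first.
  apply: eq_bigr => g _; rewrite (bigD1 c0)//= [RHS](bigD1 c0)//= /F' eqxx.
  rewrite mulrAC; congr (_ * _); apply: eq_bigr => c /negbTE cc0.
  by rewrite cc0.
rewrite -bigA_distr_bigA (bigD1 c0)//= /F' eqxx; congr (_ * _).
by apply: eq_bigr => c /negbTE ->.
Qed.

Section Weight.
Context {K : finType} (wt : K -> R).
Hypothesis wt0 : forall k, 0 <= wt k.
Hypothesis wt1 : \sum_k wt k = 1.

Fixpoint weight n : conf K n -> R :=
  if n is n'.+1 return conf K n -> R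
  then fun g => \prod_c (wt (g c).1 * weight (g c).2)
  else fun=> 1.

Lemma weight_ge0 n (g : conf K n) : 0 <= weight g.
Proof.
elim: n g => //= n IH g; apply: prodr_ge0 => c _; exact: mulr_ge0.
Qed.

Lemma sum_weight n : \sum_(g : conf K n) weight g = 1.
Proof.
elim: n => [|n IH]; first by rewrite (eq_bigr (fun=> 1))// sumr_const card_unit.
rewrite -(bigA_distr_bigA (fun _ x => wt x.1 * weight x.2)) big1// => c _.
rewrite -(pair_bigA _ (fun k g => wt k * weight g))/=.
by under eq_bigr => k _ do rewrite -mulr_sumr IH mulr1.
Qed.

(** Survival to level [n] of the tree that keeps the nodes of level [j.+1]
    whose state satisfies [b j].  The criterion may change from level to
    level, which covers the trees that are thinned from some level on. *)
Fixpoint alive n (b : nat -> pred K) : conf K n -> bool :=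
  if n is n'.+1 return conf K n -> bool
  then fun g => [exists c, b 0 (g c).1 && @alive n' (fun j => b j.+1) (g c).2]
  else xpredT.
Arguments alive {n}.

(** The composition of one generating function per level, the first level
    outermost. *)
Fixpoint extinction_prob n (b : nat -> pred K) : R :=
  if n is n'.+1
  then pgf #|C| (\sum_(k | b 0 k) wt k)
                (extinction_prob n' (fun j => b j.+1))
  else 0.

(** The tree is dead at level [n.+1] iff every child is removed or has a
    subtree dead at level [n], and the children are independent. *)
Lemma extinction_probE n b :
  \sum_(g : conf K n | ~~ alive b g) weight g = extinction_prob n b.
Proof.
elim: n b => [|n IH] b; first by rewrite big1.
pose Q := [pred x : K * conf K n | ~~ (b 0 x.1 && alive (fun j => b j.+1) x.2)].
rewrite (eq_bigl [pred g | g \in ffun_on Q]); last first.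
  by move=> g /=; rewrite negb_exists; apply/forallP/ffun_onP => h c; exact: h.
rewrite -(bigA_distr_big Q (fun _ x => wt x.1 * weight x.2)) prodr_const.
rewrite [RHS]/= /pgf; congr (_ ^+ _).
rewrite big_mkcond/=.
rewrite -(pair_bigA _ (fun k g =>
  if ~~ (b 0 k && alive (fun j => b j.+1) g) then wt k * weight g else 0))/=.
rewrite -IH -wt1 (bigID (b 0))/= addrC; congr (_ + _).
  rewrite [in RHS](bigID (b 0))/= addrAC subrr add0r.
  apply: eq_bigr => k /negbTE ->/=.
  by rewrite -mulr_sumr sum_weight mulr1.
rewrite mulr_suml; apply: eq_bigr => k ->/=.
by rewrite mulr_sumr [RHS]big_mkcond.
Qed.

Lemma alive_sub n (b b' : nat -> pred K) (g : conf K n) :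
  (forall j k, b j k -> b' j k) -> alive b g -> alive b' g.
Proof.
elim: n b b' g => // n IH b b' g bb' /= /existsP[c /andP[h1 h2]].
apply/existsP; exists c; rewrite (bb' _ _ h1)/=.
by apply: IH h2 => j k; exact: bb'.
Qed.

(** Real-valued, since its expectation is taken. *)
Fixpoint width n (a : pred K) : conf K n -> R :=
  if n is n'.+1 return conf K n -> R
  then fun g => \sum_c (a (g c).1)%:R * @width n' a (g c).2
  else fun=> 1.
Arguments width {n}.

Lemma width_ge0 n a (g : conf K n) : 0 <= width a g.
Proof. by elim: n g => //= n IH g; apply: sumr_ge0 => c _; exact: mulr_ge0. Qed.

Lemma expected_width n a :
  \sum_(g : conf K n) weight g * width a g =
  (#|C|%:R * \sum_(k | a k) wt k) ^+ n.
Proof.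
elim: n => [|n IH].
  rewrite (eq_bigr (fun=> 1)) ?expr0 ?sumr_const ?card_unit//= => g _.
  by rewrite mulr1.
under eq_bigr do rewrite mulr_sumr.
rewrite exchange_big/=.
transitivity (\sum_(c : C) (\sum_(k | a k) wt k)
   * (#|C|%:R * \sum_(k | a k) wt k) ^+ n); last first.
  by rewrite sumr_const exprS -[LHS]mulr_natl !mulrA.
apply: eq_bigr => c _.
rewrite (sum_ffun_marginal (fun _ x => wt x.1 * weight x.2)
  (fun x => (a x.1)%:R * width a x.2)).
rewrite [X in _ * X]big1 ?mulr1; last first.
  move=> c' _; rewrite -(pair_bigA _ (fun k g => wt k * weight g))/=.
  by under eq_bigr => k _ do rewrite -mulr_sumr sum_weight mulr1.
rewrite -(pair_bigA _ (fun k g => wt k * weight g * ((a k)%:R * width a g)))/=.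
rewrite -IH mulr_suml [RHS]big_mkcond/=; apply: eq_bigr => k _.
case: (a k).
  by rewrite mulr_sumr; apply: eq_bigr => g _; rewrite mul1r mulrA.
by rewrite big1// => g _; rewrite mul0r mulr0.
Qed.

End Weight.
Arguments alive {K n}.
Arguments width {K n}.

Fixpoint conf_map (K L : finType) n (a : K -> L) : conf K n -> conf L n :=
  if n is n'.+1 return conf K n -> conf L n
  then fun g => [ffun c => (a (g c).1, @conf_map K L n' a (g c).2)]
  else id.
Arguments conf_map {K L n}.

(** The least weight of a cut of the tree between the root and level [n],
    where a node of level [j] weighs [rho 0 * ... * rho j.-1]: either the
    root is cut, or each retained subtree of a child is. *)
Fixpoint cut_cost n (rho : nat -> R) : conf bool n -> R :=
  if n is n'.+1 return conf bool n -> R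
  then fun F => Num.min 1
    (\sum_(c | (F c).1) rho 0 * @cut_cost n' (fun j => rho j.+1) (F c).2)
  else fun=> 1.
Arguments cut_cost {n}.

Section Percolation.
Context {K : finType} (wt : K -> R).
Hypothesis wt0 : forall k, 0 <= wt k.
Hypothesis wt1 : \sum_k wt k = 1.
Variable a : pred K.

(** Conditionally on the tree [F] of the nodes satisfying [a], a path of the
    thinner tree must cross every cut of [F], and a given node of level
    [j] belongs to that tree with probability at most [rho 0 * ... * rho
    j.-1].  The induction compares the bound for the root with the union
    bound over its children.  The conditional statement is multiplied out
    by the probability of [F] to avoid divisions. *)
Lemma percolation_le_cut_cost n (b : nat -> pred K) (rho : nat -> R)
    (F : conf bool n) :
  (forall j, 0 <= rho j) ->
  (forall j k, b j k -> a k) ->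
  (forall j, \sum_(k | b j k) wt k <= rho j * \sum_(k | a k) wt k) ->
  \sum_(g : conf K n | (conf_map a g == F) && alive b g) weight wt g <=
  cut_cost rho F * \sum_(g : conf K n | conf_map a g == F) weight wt g.
Proof.
move=> rho0; elim: n b rho F rho0 => [|n IH] b rho F rho0 ba hb.
  by rewrite mul1r; under eq_bigl do rewrite andbT.
have w0 m (g : conf K m) : 0 <= weight wt g by exact: weight_ge0.
set M := \sum_(g | conf_map a g == F) _.
have M0 : 0 <= M by apply: sumr_ge0.
rewrite [cut_cost _ _]/= minr_pMl// le_min mul1r; apply/andP; split.
  rewrite big_mkcond [leRHS]big_mkcond/=; apply: ler_sum => g _.
  case: eqP => _ /=; last exact: lexx.
  by case: ifP => _; rewrite ?lexx//; exact: (w0 n.+1 g).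
pose W (x : K * conf K n) := wt x.1 * weight wt x.2.
have W0 x : 0 <= W x by exact: mulr_ge0.
pose match_ c (x : K * conf K n) :=
  (a x.1 == (F c).1) && (conf_map a x.2 == (F c).2).
pose G c x := (match_ c x)%:R * W x.
have matchE (g : conf K n.+1) :
    (conf_map a g == F) = [forall c, match_ c (g c)].
  apply/eqP/forallP => [Fg c|h]; first by rewrite /match_ -Fg !ffunE !eqxx.
  apply/ffunP => c; rewrite ffunE; move: (h c); rewrite /match_.
  by case: (F c) => u v /= /andP[/eqP <- /eqP <-].
have GE (g : conf K n.+1) : \prod_c G c (g c) =
    if conf_map a g == F then weight wt g else 0.
  rewrite matchE; case: ifPn => [/forallP h|].
    by apply: eq_bigr => c _; rewrite /G h mul1r.
  rewrite negb_forall => /existsP[c /negbTE h].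
  by rewrite (bigD1 c)//= /G h !mul0r.
have ME : M = \prod_c \sum_x G c x.
  by rewrite bigA_distr_bigA /M big_mkcond; apply: eq_bigr => g _; rewrite GE.
pose B (x : K * conf K n) : R := (b 0 x.1 && alive (fun j => b j.+1) x.2)%:R.
have union_bound (g : conf K n.+1) :
    (if (conf_map a g == F) && alive b g then weight wt g else 0) <=
    \sum_c (\prod_c' G c' (g c')) * B (g c).
  rewrite -mulr_sumr GE.
  case: (boolP (conf_map a g == F)) => /= _; last by rewrite mul0r.
  case: ifPn => [/existsP[c hc]|_]; last first.
    by apply: mulr_ge0; [exact: (w0 n.+1 g)|exact: sumr_ge0].
  rewrite ler_peMr//; first exact: (w0 n.+1 g).
  by rewrite (bigD1 c)//= /B hc lerDl; apply: sumr_ge0.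
apply: (@le_trans _ _ (\sum_c \sum_(g : conf K n.+1)
    (\prod_c' G c' (g c')) * B (g c))).
  by rewrite exchange_big big_mkcond; apply: ler_sum => g _; exact: union_bound.
rewrite mulr_suml [leRHS]big_mkcond/=; apply: ler_sum => c _.
rewrite sum_ffun_marginal ME (@bigD1 _ _ _ _ c xpredT)//=.
set P := \prod_(_ | _) _.
have P0 : 0 <= P.
  by apply: prodr_ge0 => c' _; apply: sumr_ge0 => x _; exact: mulr_ge0.
(* The factors of the other children are common to both sides. *)
suff one_child : \sum_x G c x * B x <=
    if (F c).1 then rho 0 * cut_cost (fun j => rho j.+1) (F c).2 * \sum_x G c x
    else 0.
  apply: (le_trans (ler_wpM2r P0 one_child)).
  by case: ifP => _; rewrite ?mul0r// !mulrA.
rewrite -(pair_bigA _ (fun k g => G c (k, g) * B (k, g)))/=.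
rewrite -(pair_bigA _ (fun k g => G c (k, g)))/=.
have GB k g : G c (k, g) * B (k, g) =
  (a k == (F c).1)%:R * (b 0 k)%:R * wt k *
  ((conf_map a g == (F c).2) && alive (fun j => b j.+1) g)%:R * weight wt g.
  by rewrite /G /B /match_ /W/= -!mulnb !natrM; ring.
have GG k g : G c (k, g) = (a k == (F c).1)%:R * wt k *
  ((conf_map a g == (F c).2)%:R * weight wt g).
  by rewrite /G /match_ /W/= -!mulnb !natrM; ring.
case: ifPn => [Fc|/negbTE Fc]; last first.
  rewrite big1// => k _; rewrite big1// => g _; rewrite GB Fc.
  have := ba 0 k; case: (b 0 k); case: (a k) => //=; rewrite ?mul0r//.
    by move=> /(_ isT).
  by rewrite mulr0 !mul0r.
have -> : \sum_k \sum_g G c (k, g) * B (k, g) = (\sum_(k | b 0 k) wt k) *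
   \sum_(g | (conf_map a g == (F c).2) && alive (fun j => b j.+1) g)
     weight wt g.
  rewrite [in RHS]big_mkcond mulr_suml; apply: eq_bigr => k _.
  rewrite [in RHS]big_mkcond mulr_sumr; apply: eq_bigr => g _.
  rewrite GB Fc; case: (boolP (b 0 k)) => [/ba ->|_].
    by case: (_ && _); rewrite !mul1r ?mulr1// !mulr0 mul0r.
  by rewrite mulr0 !mul0r.
have -> : \sum_k \sum_g G c (k, g) = (\sum_(k | a k) wt k) *
   \sum_(g | conf_map a g == (F c).2) weight wt g.
  rewrite [in RHS]big_mkcond mulr_suml; apply: eq_bigr => k _.
  rewrite [in RHS]big_mkcond mulr_sumr; apply: eq_bigr => g _.
  rewrite GG Fc; case: (a k) => /=; last by rewrite !mul0r.
  by case: (_ == _); rewrite ?mul1r// !mul0r !mulr0.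
rewrite mulrACA; apply: ler_pM => //.
- by apply: sumr_ge0 => *; exact: wt0.
- by apply: sumr_ge0 => *; exact: w0.
- apply: (IH (fun j => b j.+1)) => [j|j k|j]; [exact: rho0|exact: ba|].
  exact: hb.
Qed.

(** The previous bound, summed over the trees [F] that have a cheap cut. *)
Lemma percolation_lt_cut_cost n (b : nat -> pred K) (rho : nat -> R) (e : R) :
  0 <= e ->
  (forall j, 0 <= rho j) ->
  (forall j k, b j k -> a k) ->
  (forall j, \sum_(k | b j k) wt k <= rho j * \sum_(k | a k) wt k) ->
  \sum_(g : conf K n | (cut_cost rho (conf_map a g) < e) && alive b g)
    weight wt g <= e.
Proof.
move=> e0 rho0 ba hb.
rewrite (partition_big (conf_map a) (fun F => cut_cost rho F < e))/=;
  last by move=> g /andP[].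
apply: (@le_trans _ _ (\sum_(F : conf bool n | cut_cost rho F < e)
   e * \sum_(g : conf K n | conf_map a g == F) weight wt g)).
  apply: ler_sum => F hF.
  apply: (le_trans _ (ler_wpM2r (sumr_ge0 _ _) (ltW hF))); last first.
    by move=> g _; exact: weight_ge0.
  rewrite (eq_bigl (fun g => (conf_map a g == F) && alive b g)).
    exact: percolation_le_cut_cost.
  move=> g; case: eqP => [->|_]; last by rewrite andbF.
  by rewrite hF andbT.
rewrite -mulr_sumr ler_piMr//.
rewrite -(sum_weight wt1 n) [leRHS](partition_big (conf_map a) xpredT)//=.
rewrite [leRHS](bigID (fun F => cut_cost rho F < e))/= lerDl.
by apply: sumr_ge0 => F _; apply: sumr_ge0 => g _; exact: weight_ge0.
Qed.

End Percolation.

End FiniteTrees.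

(** * The law of the configuration of independent node states *)

Section RandomConfiguration.
Context {R : realType} {C K : finType}.

(** The configuration read off from the states of the nodes, a node being
    named by the path leading to it from the root. *)
Fixpoint conf_of n (x : seq C -> K) : @conf C K n :=
  if n is n'.+1 return conf K n
  then [ffun c => (x [:: c], conf_of n' (fun p => x (c :: p)))]
  else tt.

(** The paths to the nodes of levels 1 to [n]. *)
Fixpoint words n : seq (seq C) :=
  if n is n'.+1 then [seq c :: p | c <- enum C, p <- [::] :: words n']
  else [::].

(** The state of a node in a configuration.  Configurations do not record the
    state of the root, which has to be supplied as [k]. *)
Fixpoint state n k : @conf C K n -> seq C -> K :=
  if n is n'.+1 return conf K n -> seq C -> K
  then fun g p => if p is c :: p' then @state n' (g c).1 (g c).2 p' else k
  else fun _ _ => k.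
Arguments state {n}.

Lemma state_nil n k (g : conf K n) : state k g [::] = k.
Proof. by case: n g. Qed.

Lemma words_neq0 n : [::] \notin words n.
Proof. by case: n => // n; apply/allpairsP => -[[c p]] []. Qed.

Lemma uniq_words n : uniq (words n).
Proof.
elim: n => // n IH; apply: allpairs_uniq; first exact: enum_uniq.
  by rewrite cons_uniq words_neq0.
by move=> [c p] [c' p'] _ _ [-> ->].
Qed.

Lemma mem_words n p : (p \in words n) = (0 < size p <= n)%N.
Proof.
elim: n p => [|n IH] p; first by case: p.
apply/allpairsP/idP => [[[c q] /= [_ + ->]]|].
  by rewrite in_cons IH => /orP[/eqP->//|/andP[]].
case: p => // c p /= h; exists (c, p); rewrite /= mem_enum in_cons IH.
by split=> //; case: p h.
Qed.

Lemma conf_of_eqP n k (x : seq C -> K) (g : conf K n) :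
  conf_of n x = g <-> (forall p, p \in words n -> x p = state k g p).
Proof.
elim: n k x g => [|n IH] k x g; first by split=> //; case: g.
split=> [<- p /allpairsP[[c q]/= [_ + ->]]|h].
  rewrite ffunE/= in_cons => /predU1P[->|qw]; first by rewrite state_nil.
  exact: (IH (x [:: c]) (fun q => x (c :: q)) _).1.
apply/ffunP => c; rewrite ffunE.
have -> : x [:: c] = (g c).1.
  by rewrite (h [:: c]) ?mem_words//= state_nil.
rewrite [RHS]surjective_pairing; congr (_, _).
apply/(IH (g c).1) => p pw.
rewrite h//; apply/allpairsP; exists (c, p).
by rewrite mem_enum in_cons pw orbT.
Qed.

Lemma weight_words (wt : K -> R) n k (g : conf K n) :
  weight wt g = \prod_(p <- words n) wt (state k g p).
Proof.
elim: n k g => [|n IH] k g; first by rewrite big_nil.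
rewrite [RHS]big_allpairs_dep big_enum/=; apply: eq_bigr => c _.
by rewrite big_cons/= (IH (g c).1) state_nil.
Qed.

End RandomConfiguration.
Arguments conf_of {C K}.

Section FiniteValued.
Context {R : realType} {disp : measure_display} {T : measurableType disp}.
Variable mu : {measure set T -> \bar R}.

Lemma measurable_finite_valued (K : finType) (f : T -> K) (A : pred K) :
  (forall k, measurable [set w | f w = k]) -> measurable [set w | A (f w)].
Proof.
move=> mf.
rewrite (_ : [set _ | _] = \bigcup_(k in [set k | A k]) [set w | f w = k]).
  by apply: fin_bigcup_measurable => //; exact: finite_finset.
by apply/seteqP; split=> [w /= ?|w [k /= Ak ->]//]; exists (f w).
Qed.

(** The event is the disjoint union of finitely many fibres of [f]. *)
Lemma measure_finite_valued (K : finType) (f : T -> K) (m : K -> R)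
    (A : pred K) :
  (forall k, measurable [set w | f w = k]) ->
  (forall k, mu [set w | f w = k] = (m k)%:E) ->
  mu [set w | A (f w)] = (\sum_(k | A k) m k)%:E.
Proof.
move=> mf fm.
rewrite (_ : [set _ | _] = \bigcup_(k in [set` enum A]) [set w | f w = k]).
  rewrite measure_fin_bigcup//; last first.
    by move=> k k' _ _ [w [/= -> ->]].
  rewrite -fsbig_seq ?enum_uniq// big_enum/= -sumEFin.
  by apply: eq_bigr => k _; rewrite fm.
apply/seteqP; split=> [w /= Aw|w [k /= ]].
  by exists (f w) => //=; rewrite mem_enum.
by rewrite mem_enum => Ak ->.
Qed.

End FiniteValued.

Section ConfigurationLaw.
Context {R : realType} {disp : measure_display} {T : measurableType disp}.
Context {C K : finType}.
Variables (P : probability T R) (wt : K -> R) (Z : seq C -> T -> K).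
Hypothesis mZ : forall p k, measurable [set w | Z p w = k].
Hypothesis Z_indep : forall (s : seq (seq C)) (f : seq C -> K), uniq s ->
  P (\bigcap_(p in [set` s]) [set w | Z p w = f p]) =
  (\prod_(p <- s) wt (f p))%:E.

Lemma conf_of_fiber n (g : conf K n) : [set w | conf_of n (Z^~ w) = g] =
  \bigcap_(p in [set` @words C n]) [set w | Z p w = state (Z [::] point) g p].
Proof.
by apply/seteqP; split=> w /=;
  rewrite (conf_of_eqP (Z [::] point)) => h p /h.
Qed.

Lemma measurable_conf_fiber n (g : conf K n) :
  measurable [set w | conf_of n (Z^~ w) = g].
Proof.
by rewrite conf_of_fiber; apply: fin_bigcap_measurable => // p _; exact: mZ.
Qed.

Lemma conf_of_law n (g : conf K n) :
  P [set w | conf_of n (Z^~ w) = g] = (weight wt g)%:E.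
Proof.
by rewrite conf_of_fiber Z_indep ?uniq_words// -weight_words.
Qed.

Lemma measurable_conf_event n (A : pred (conf K n)) :
  measurable [set w | A (conf_of n (Z^~ w))].
Proof. exact/measurable_finite_valued/measurable_conf_fiber. Qed.

Lemma conf_event_probability n (A : pred (conf K n)) :
  P [set w | A (conf_of n (Z^~ w))] = (\sum_(g | A g) weight wt g)%:E.
Proof.
by apply: measure_finite_valued => g;
  [exact: measurable_conf_fiber|exact: conf_of_law].
Qed.

End ConfigurationLaw.

(** * Paths, infinite branches and dyadic nodes *)

Section Konig.
Context {C : finType}.

(** The branch is built by always moving to a child above which the tree is
    infinite.  If all children had finite trees above them, the maximum
    of their heights would bound the height above the parent. *)
Lemma konig (G : seq C -> Prop) :
  (forall p c, G (rcons p c) -> G p) ->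
  (forall n, exists2 p, size p = n & G p) ->
  exists f : nat -> C, forall n, G (mkseq f n).
Proof.
move=> Gpre Ginf.
have Gcat p q : G (p ++ q) -> G p.
  elim/last_ind: q => [|q c IH]; first by rewrite cats0.
  by rewrite -rcons_cat => /Gpre.
pose inf p := forall n, exists2 q, size q = n & G (p ++ q).
have step p : inf p -> exists c, inf (rcons p c).
  move=> ip; apply: contrapT => nc.
  have /choice[N hN] : forall c, exists n, forall q, size q = n ->
      ~ G (rcons p c ++ q).
    move=> c; apply: contrapT => h; apply: nc; exists c => n.
    apply: contrapT => h'; apply: h; exists n => q sq Gq.
    by apply: h'; exists q.
  have [[//|c q] /= [sq] Gq] := ip (\max_c N c).+1.
  have Nq : (N c <= size q)%N by rewrite sq leq_bigmax.
  apply: (hN c (take (N c) q)); first by rewrite size_takel.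
  by apply: (@Gcat _ (drop (N c) q)); rewrite -catA cat_take_drop cat_rcons.
have /choice[h hh] : forall p, exists c, inf p -> inf (rcons p c).
  move=> p; have [/step[c ic]|ni] := pselect (inf p); first by exists c.
  by have [[//|c q] _ _] := Ginf 1%N; exists c.
pose path n := iter n (fun p => rcons p (h p)) [::].
exists (fun n => h (path n)) => n.
have -> : mkseq (fun n => h (path n)) n = path n.
  by elim: n => // n IH; rewrite mkseqS IH.
apply: (@Gcat _ [::]); rewrite cats0.
suff : inf (path n) by move=> /(_ 0%N)[[]// _]; rewrite cats0.
by elim: n => [|n IH]; [exact: Ginf|exact: hh].
Qed.

(** All nodes of the path except the root satisfy [x]. *)
Fixpoint open_path (x : seq C -> bool) p : bool :=
  if p is c :: p' then x [:: c] && open_path (fun q => x (c :: q)) p' else true.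

Lemma open_path_rcons x p c :
  open_path x (rcons p c) = open_path x p && x (rcons p c).
Proof. by elim: p x => [|c' p IH] x /=; rewrite ?andbT// IH andbA. Qed.

Lemma alive_conf_ofP (K : finType) n (a : pred K) (z : seq C -> K) :
  reflect (exists2 p, size p = n & open_path (fun q => a (z q)) p)
          (alive (fun=> a) (conf_of n z)).
Proof.
elim: n z => [|n IH] z; first by left; exists [::].
apply: (iffP existsP) => [[c]|[[//|c p] [sp] /= /andP[ac op]]].
  rewrite ffunE => /andP[ac /IH[p sp op]].
  exists (c :: p); first by rewrite /= sp.
  by rewrite /= ac.
by exists c; rewrite ffunE /= ac; apply/IH; exists p.
Qed.

End Konig.

Section DyadicNodes.
Context {d : nat}.
Local Notation C := {ffun 'I_d -> bool}.
Implicit Types (p q : seq C) (k l : 'rV[int]_d) (c : C).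

Definition child k c : 'rV[int]_d := \row_i (k 0 i * 2 + (c i : nat)%:Z).

Definition node p : 'rV[int]_d := foldl child 0 p.

Lemma node_rcons p c : node (rcons p c) = child (node p) c.
Proof. exact: foldl_rcons. Qed.

Lemma childK c : cancel (child^~ c) parent.
Proof.
move=> k; apply/rowP => i; rewrite !mxE divzMDl// divz_small ?addr0//.
by case: (c i).
Qed.

Lemma child_inj k c c' : child k c = child k c' -> c = c'.
Proof.
move=> /rowP h; apply/ffunP => i; have := h i; rewrite !mxE.
by move/addrI; case: (c i); case: (c' i).
Qed.

Lemma child_surj l : exists c, l = child (parent l) c.
Proof.
exists [ffun i => modz (l 0 i) 2 == 1]; apply/rowP => i; rewrite !mxE ffunE.
rewrite {1}(divz_eq (l 0 i) 2); congr (_ + _).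
have := modz_ge0 (l 0 i) (isT : 2 != 0 :> int).
have := ltz_pmod (l 0 i) (isT : 0 < 2 :> int).
by case: (_ %% _)%Z => // -[|[]].
Qed.

Lemma node_inj p q : size p = size q -> node p = node q -> p = q.
Proof.
elim/last_ind: p q => [|p c IH] q; first by case: q.
case/lastP: q => [|q c']; rewrite !size_rcons// => -[spq].
rewrite !node_rcons => e; have e' : node p = node q.
  by rewrite -[LHS](childK c) e childK.
by rewrite (IH q)//; congr rcons; apply: (@child_inj (node q)); rewrite -{1}e'.
Qed.

Lemma node_itv p i : 0 <= node p 0 i < 2 ^+ size p.
Proof.
elim/last_ind: p => [|p c /andP[h0 h1]].
  by rewrite /node/= mxE lexx expr0 ltr01.
rewrite node_rcons mxE size_rcons exprSr; apply/andP; split.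
  by apply: addr_ge0 => //; exact: mulr_ge0.
have h2 : (c i : nat)%:Z <= 1 by case: (c i).
by apply: (le_lt_trans (lerD (lexx _) h2)); move: h1; lia.
Qed.

Section Level.
Context {disp : measure_display} {Omega : measurableType disp} {R : realType}.
Context {P : probability Omega R}.
Variables (beta : R) (t : nat -> 'rV[int]_d -> {RV P >-> R}) (w : Omega).

Definition retained p : bool := t (size p) (node p) w < beta.

Lemma level_nodeP p :
  level beta t w (size p) (node p) <-> open_path retained p.
Proof.
elim/last_ind: p => [|p c IH]; first by [].
rewrite size_rcons open_path_rcons/= {1}node_rcons childK; split.
  move=> [/IH -> h]; rewrite /retained size_rcons; exact: h.
move=> /andP[/IH hp]; rewrite /retained size_rcons => h; split => //.
Qed.

Lemma level_node j k : level beta t w j k ->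
  exists p, [/\ size p = j, node p = k & open_path retained p].
Proof.
move=> h; suff [p sp np] : exists2 p, size p = j & node p = k.
  by exists p; split => //; apply/level_nodeP; rewrite sp np.
elim: j k h => [|j IH] k /=; first by move=> ->; exists [::].
move=> [/IH[p sp np] _]; have [c kc] := child_surj k.
by exists (rcons p c); rewrite ?size_rcons ?sp// node_rcons np -kc.
Qed.

End Level.
End DyadicNodes.

(** * Dyadic cubes *)

Section DyadicCubes.
Context {R : realType} {d : nat}.
Local Notation C := {ffun 'I_d -> bool}.
Implicit Types (p q : seq C) (k : 'rV[int]_d) (y : 'rV[R]_d).

Definition box j k : set 'rV[R]_d :=
  [set y | forall i, (k 0 i)%:~R <= 2 ^+ j * y 0 i <= (k 0 i)%:~R + 1].

Lemma closure_cube_sub j k : closure (cube j k) `<=` box j k.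
Proof.
move=> y cy i.
suff h e : 0 < e -> (k 0 i)%:~R - e <= 2 ^+ j * y 0 i <= (k 0 i)%:~R + 1 + e.
  apply/andP; split; apply/ler_addgt0Pr => e /h /andP[].
    by rewrite lerBlDr.
  by [].
move=> e0; have e'0 : 0 < e / 2 ^+ j :> R by rewrite divr_gt0// exprn_gt0.
have [z [[_ zk] yz]] := cy _ (nbhsx_ballx y _ e'0).
have := floor_itv (2 ^+ j * z 0 i); move/rowP: zk => /(_ i); rewrite mxE => ->.
have : `|(y 0 i - z 0 i) * 2 ^+ j| < e.
  rewrite normrM (gtr0_norm (exprn_gt0 j _))// -ltr_pdivlMr ?exprn_gt0//.
  exact: yz.2.
by rewrite ltr_norml rmorphD/= !(mulrC (_ ^+ _)); lra.
Qed.

(** The half-open cube contains the lower corner of the box, so a point of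
    the box is approximated by pulling its coordinates towards that
    corner. *)
Lemma box_sub_closure_cube j k : (forall i, 0 <= k 0 i < 2 ^+ j) ->
  box j k `<=` closure (cube j k).
Proof.
move=> hk y hy B /nbhs_ballP[e /= e0 yB].
have p0 : 0 < 2 ^+ j :> R by rewrite exprn_gt0.
pose z : 'rV[R]_d := \row_i Num.max ((k 0 i)%:~R / 2 ^+ j) (y 0 i - e / 2).
have zE i : (k 0 i)%:~R <= 2 ^+ j * z 0 i < (k 0 i)%:~R + 1.
  rewrite mxE (maxr_pMr _ _ (ltW p0)) [2 ^+ j * (_ / _)]mulrC divfK ?gt_eqF//.
    rewrite le_max lexx/= gt_max ltrDl ltr01/= mulrBr.
  have /andP[_ h] := hy i; apply: lt_le_trans h.
  by rewrite ltrBlDr ltrDl mulr_gt0// divr_gt0.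
exists z; split; last first.
  apply: yB; split => // i' i; rewrite ord1 /ball/= mxE.
  have h : (k 0 i)%:~R / 2 ^+ j <= y 0 i.
    by rewrite ler_pdivrMr// mulrC; have /andP[] := hy i.
  rewrite ltr_distlC gt_max lt_max; apply/andP; split.
    by apply/orP; right; lra.
  by apply/andP; split; [apply: (le_lt_trans h)|]; lra.
split=> [i|]; last first.
  apply/rowP => i; rewrite mxE; apply: floor_def.
  by rewrite rmorphD/=; exact: zE.
have /andP[h1 h2] := zE i; have /andP[k0 k1] := hk i; apply/andP; split.
  rewrite -(pmulr_rge0 _ p0); apply: le_trans h1; rewrite ler0z//.
have k1' : (k 0 i)%:~R + 1 <= 2 ^+ j :> R.
  by move: k1; rewrite -lezD1 -(ler_int R) rmorphD/= rmorphXn.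
by rewrite -(ler_pM2l p0) mulr1; apply/ltW/(lt_le_trans h2).
Qed.

(** The boxes along a branch are nested, and nested segments have a common
    point in each coordinate. *)
Lemma branch_point (f : nat -> C) :
  exists y, forall n, box n (node (mkseq f n)) y.
Proof.
pose lo i n : R := (node (mkseq f n) 0 i)%:~R / 2 ^+ n.
pose hi i n : R := ((node (mkseq f n) 0 i)%:~R + 1) / 2 ^+ n.
have p0 n : 0 < 2 ^+ n :> R by rewrite exprn_gt0.
have nodeS i n : (node (mkseq f n.+1) 0 i)%:~R =
    (node (mkseq f n) 0 i)%:~R * 2 + (f n i : nat)%:R :> R.
  by rewrite mkseqS node_rcons mxE rmorphD rmorphM.
have loS i n : lo i n <= lo i n.+1.
  rewrite /lo nodeS ler_pdivlMr// exprSr mulrA divfK ?gt_eqF//.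
  by rewrite lerDl.
have hiS i n : hi i n.+1 <= hi i n.
  rewrite /hi nodeS ler_pdivrMr// exprSr mulrA divfK ?gt_eqF//.
  by rewrite mulrDl -addrA lerD2l mul1r; case: (f n i) => /=; lra.
have lo_mono i : nondecreasing_seq (lo i) by apply/nondecreasing_seqP.
have hi_mono i : nonincreasing_seq (hi i) by apply/nonincreasing_seqP.
have lohi i m n : lo i m <= hi i n.
  apply: (@le_trans _ _ (lo i (maxn m n))); first by rewrite lo_mono// leq_maxl.
  apply: (@le_trans _ _ (hi i (maxn m n))); last by rewrite hi_mono// leq_maxr.
  by rewrite /lo /hi ler_pM2r ?invr_gt0// lerDl.
exists (\row_i sup (range (lo i))) => n i; rewrite mxE; apply/andP; split.
  rewrite mulrC -ler_pdivrMr//; apply: ub_le_sup; last by exists n.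
  by exists (hi i 0%N) => _ [m _ <-].
rewrite mulrC -ler_pdivlMr//; apply: ge_sup; first by exists (lo i 0%N), 0%N.
by move=> _ [m _ <-]; exact: (lohi i m n).
Qed.

End DyadicCubes.

(** * Hausdorff measures *)

Section HausdorffBasics.
Context {R : realType} {d : nat}.
Implicit Types (U A : set 'rV[R]_d) (s r : R).
(* The name also denotes an extended distance on pseudometric spaces. *)
Local Notation edist := Defs.edist.

Lemma edist_ge0 (x y : 'rV[R]_d) : 0 <= edist x y.
Proof. exact: sqrtr_ge0. Qed.

Lemma coord_le_edist (x y : 'rV[R]_d) i : `|x 0 i - y 0 i| <= edist x y.
Proof.
rewrite -sqrtr_sqr; apply: ler_wsqrtr; rewrite (bigD1 i)//= lerDl.
by apply: sumr_ge0 => j _; exact: sqr_ge0.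
Qed.

Lemma edist_le_coord (x y : 'rV[R]_d) r : 0 <= r ->
  (forall i, `|x 0 i - y 0 i| <= r) -> edist x y <= Num.sqrt d%:R * r.
Proof.
move=> r0 h; rewrite -[in leRHS](ger0_norm r0) -sqrtr_sqr -sqrtrM//.
apply: ler_wsqrtr; apply: (@le_trans _ _ (\sum_(i < d) r ^+ 2)).
  apply: ler_sum => i _; rewrite -real_normK ?num_real//.
  by apply: lerXn2r; rewrite ?nnegrE.
by rewrite sumr_const card_ord mulr_natl.
Qed.

Lemma diam_le_fin U r : U !=set0 -> (diam U <= r%:E)%E ->
  exists2 r', 0 <= r' <= r & diam U = r'%:E.
Proof.
move=> [x Ux] Ur.
have : (0%E <= diam U)%E.
  apply: (@le_trans _ _ (edist x x)%:E); first by rewrite lee_fin edist_ge0.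
  by apply: ereal_sup_ubound; exists x, x.
case: (diam U) Ur => [r'| |]//; rewrite !lee_fin => h1 h2.
by exists r'; rewrite ?h2.
Qed.

Lemma edist_le_diam U r x y : diam U = r%:E -> U x -> U y -> edist x y <= r.
Proof.
move=> Ur Ux Uy; rewrite -lee_fin -Ur; apply: ereal_sup_ubound.
by exists x, y.
Qed.

Lemma diam_pow_ge0 s U : (0 <= diam_pow s U)%E.
Proof. by rewrite /diam_pow; case: asboolP => // _; exact: poweR_ge0. Qed.

Lemma diam_powE s U r : U !=set0 -> diam U = r%:E ->
  diam_pow s U = (r `^ s)%:E.
Proof.
by move=> /set0P/eqP U0 Ur; rewrite /diam_pow asboolF// Ur poweR_EFin.
Qed.

Lemma diam_pow_le s U r : 0 <= s -> 0 <= r -> (diam U <= r%:E)%E ->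
  (diam_pow s U <= (r `^ s)%:E)%E.
Proof.
move=> s0 r0 Ur; have [->|/set0P U0] := eqVneq U set0.
  by rewrite /diam_pow asboolT// lee_fin powR_ge0.
have [r' /andP[r'0 r'r] Ur'] := diam_le_fin U0 Ur.
by rewrite (diam_powE s U0 Ur') lee_fin; apply: ge0_ler_powR.
Qed.

Lemma diam_set0 : (diam (@set0 'rV[R]_d) = -oo)%E.
Proof.
rewrite /diam (_ : [set _ | _] = set0) ?ereal_sup0//.
by apply/seteqP; split=> // e [x [y []]].
Qed.

Lemma premeasure_finite_cover s delta A r (L : seq (set 'rV[R]_d)) :
  0 <= s -> 0 <= r <= delta -> (A `<=` \bigcup_(U in [set` L]) U) ->
  (forall U, U \in L -> (diam U <= r%:E)%E) ->
  (hausdorff_premeasure s delta A <= ((size L)%:R * r `^ s)%:E)%E.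
Proof.
move=> s0 /andP[r0 rdelta] AL Lr; pose U n := nth set0 L n.
have Ur n : (diam (U n) <= r%:E)%E.
  rewrite /U; have [nL|nL] := ltnP n (size L); first by rewrite Lr// mem_nth.
  by rewrite nth_default// diam_set0 leNye.
apply: (@le_trans _ _ (\sum_(0 <= n <oo) diam_pow s (U n))%E).
  apply: ereal_inf_lbound; exists U; split=> //.
  - move=> x /AL[V /= VL Vx]; exists (index V L) => //.
    by rewrite /U nth_index.
  - by move=> n; apply: (le_trans (Ur n)); rewrite lee_fin.
rewrite (nneseries_split 0%N (size L)); last by move=> k _; exact: diam_pow_ge0.
rewrite eseries0 ?adde0; last first.
  move=> i; rewrite add0n => Li _; rewrite /U nth_default// /diam_pow.
  by rewrite asboolT.
apply: (@le_trans _ _ (\sum_(0 <= k < 0 + size L) (r `^ s)%:E)%E).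
  by apply: lee_sum => i _; exact: diam_pow_le.
by rewrite sumEFin add0n sumr_const_nat subn0 mulr_natl.
Qed.

Lemma premeasure_ge0 s delta A : (0 <= hausdorff_premeasure s delta A)%E.
Proof.
apply: le_ereal_inf_tmp => _ [U [_ _ ->]].
by apply: nneseries_ge0 => n _ _; exact: diam_pow_ge0.
Qed.

Lemma hausdorff_measure_eq0 s A :
  (forall delta e, 0 < delta -> 0 < e ->
     (hausdorff_premeasure s delta A <= e%:E)%E) ->
  hausdorff_measure s A = 0%E.
Proof.
move=> h; apply/eqP; rewrite eq_le; apply/andP; split.
  apply: ge_ereal_sup => _ [delta /= delta0 <-].
  by apply/lee_addgt0Pr => e e0; rewrite add0e; exact: h.
apply: le_trans (premeasure_ge0 s 1 A) _.
by apply: ereal_sup_ubound; exists 1 => //=; exact: ltr01.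
Qed.

Lemma hausdorff_measure0_cover s A e : hausdorff_measure s A = 0%E -> 0 < e ->
  exists U : nat -> set 'rV[R]_d,
    [/\ A `<=` \bigcup_n U n, forall n, (diam (U n) <= 1%:E)%E
      & (\sum_(0 <= n <oo) diam_pow s (U n) < e%:E)%E].
Proof.
move=> A0 e0.
have : (hausdorff_premeasure s 1 A < e%:E)%E.
  apply: (@le_lt_trans _ _ 0%E); last by rewrite lte_fin.
  rewrite -A0; apply: ereal_sup_ubound; exists 1 => //=; exact: ltr01.
by move=> /ereal_inf_lt[_ [U [AU U1 ->]] h]; exists U; split.
Qed.

Lemma powR2N_lt1 (s : R) : 0 < s -> 2 `^ (- s) < 1 :> R.
Proof.
move=> s0.
rewrite powRN invf_lt1 ?powR_gt0// -[ltLHS](congr1 (@^~ s) (powR1 R)).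
by apply: gt0_ltr_powR; rewrite ?nnegrE// ltr1n.
Qed.

Lemma half_expr_powR s n : (2^-1 ^+ n) `^ s = (2 `^ (- s)) ^+ n :> R.
Proof.
rewrite -[2^-1 ^+ n]powR_mulrn ?invr_ge0// powRAC powR_mulrn ?powR_ge0//.
congr (_ ^+ _).
by rewrite powRN -powR_inv1// -powRrM mulN1r powRN.
Qed.

(** The scale [j] is the last one at which [2 ^ (- j)] is not below [r].  The
    error [e] accounts for [r = 0], where every scale is too coarse. *)
Lemma dyadic_scale (r s e : R) : 0 <= r <= 1 -> 0 < s -> 0 < e ->
  exists j, r <= 2^-1 ^+ j /\ (2 `^ (- s)) ^+ j <= 2 `^ s * r `^ s + e.
Proof.
move=> /andP[r0 r1] s0 e0.
have q0 : 0 < 2 `^ (- s) :> R by rewrite powR_gt0.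
have q1 := powR2N_lt1 s0.
have vanish (q : R) x : 0 < q < 1 -> 0 < x -> exists j, q ^+ j < x.
  move=> /andP[q'0 q'1] x0.
  have : (fun j => q ^+ j) @ \oo --> (0 : R).
    by apply: cvg_expr; rewrite gtr0_norm.
  move=> /cvgrPdist_lt/(_ _ x0)[j _ /(_ j (leqnn _))] /=.
  by rewrite sub0r normrN gtr0_norm ?exprn_gt0// => h; exists j.
have half : 0 < (2^-1 : R) < 1 by rewrite invr_gt0 ltr0n invf_lt1// ltr1n.
have half0 : 0 <= 2^-1 :> R by rewrite invr_ge0.
have [r00|rn0] := eqVneq r 0.
  have [j hj] := vanish (2 `^ (- s)) e (introT andP (conj q0 q1)) e0.
  exists j; rewrite r00 exprn_ge0//.
  by split => //; rewrite powR0 ?gt_eqF// mulr0 add0r ltW.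
have rp : 0 < r by rewrite lt_neqAle eq_sym rn0.
have ex : exists j, (2^-1) ^+ j < r by exact: vanish.
case: (ex_minnP ex) => m hm mmin.
have m0 : (0 < m)%N.
  by rewrite lt0n; apply/eqP => m0; have := hm; rewrite m0 expr0; lra.
exists m.-1; split.
  by rewrite leNgt; apply/negP => /mmin; rewrite leqNgt prednK// leqnn.
have -> : (2 `^ (- s)) ^+ m.-1 = 2 `^ s * (2^-1 ^+ m) `^ s :> R.
  rewrite half_expr_powR.
  rewrite -{2}(prednK m0) exprS mulrA -powRD ?subrr ?powRr0 ?mul1r//.
  by rewrite pnatr_eq0 implybT.
apply: ler_wpDr; first exact: ltW.
apply: ler_wpM2l; first exact: powR_ge0.
by apply: ge0_ler_powR; rewrite ?nnegrE ?exprn_ge0 ?ltW.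
Qed.

End HausdorffBasics.

(** * Hausdorff measure of the limit set of a tree *)

Section CoveringTrees.
Context {R : realType} {d : nat}.
Local Notation C := {ffun 'I_d -> bool}.
Implicit Types (p q : seq C) (U A : set 'rV[R]_d).

Lemma box_diam j k : (diam (box j k : set 'rV[R]_d) <=
  (Num.sqrt d%:R * 2^-1 ^+ j)%:E)%E.
Proof.
apply: ge_ereal_sup => _ [x [y [xk yk ->]]]; rewrite lee_fin.
have p0 : 0 < 2 ^+ j :> R by rewrite exprn_gt0.
apply: edist_le_coord => [|i]; first by rewrite exprn_ge0// invr_ge0.
rewrite exprVn -(ler_pM2l p0) mulfV ?gt_eqF// -{1}(gtr0_norm p0) -normrM mulrBr.
by rewrite ler_norml; have := xk i; have := yk i; lra.
Qed.

(** Turns the recursive count [width] into the length of an enumeration. *)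
Lemma open_paths_enum n (x : seq C -> bool) :
  exists L : seq (seq C), (size L)%:R = width id (conf_of n x) :> R /\
    forall p, size p = n -> open_path x p -> p \in L.
Proof.
elim: n x => [|n IH] x.
  by exists [:: [::]]; split=> // p /size0nil ->; rewrite inE.
have /choice[L hL] := fun c : C => IH (fun q => x (c :: q)).
exists (flatten [seq [seq c :: q | q <- L c] | c <- enum C & x [:: c]]).
split=> [|[//|c p] [sp] /= /andP[xc op]].
  rewrite size_flatten /shape sumnE big_map big_map big_filter big_enum_cond/=.
  rewrite natr_sum big_mkcond/=; apply: eq_bigr => c _.
  rewrite ffunE/= size_map (hL c).1.
  by case: (x [:: c]); rewrite ?mul1r ?mul0r.
apply/flatten_mapP; exists c; first by rewrite mem_filter xc mem_enum.
by apply: map_f; exact: (hL c).2.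
Qed.

(** The boxes of level [n] have diameter [sqrt d * 2 ^ (- n)], and there are
    [width] many of them. *)
Lemma hausdorff_measure_eq0_width (x : seq C -> bool) A s :
  0 <= s ->
  (forall n, (0 < n)%N -> A `<=` [set y | exists p,
     [/\ size p = n, open_path x p & box n (node p) y]]) ->
  (forall e M, 0 < e -> exists2 n, (M <= n)%N &
     width id (conf_of n x) * (2 `^ (- s)) ^+ n < e) ->
  hausdorff_measure s A = 0%E.
Proof.
move=> s0 Acover small; apply: hausdorff_measure_eq0 => delta e delta0 e0.
set D : R := Num.sqrt d%:R `^ s.
have D0 : 0 <= D by exact: powR_ge0.
have half0 : 0 <= 2^-1 :> R by rewrite invr_ge0.
have [M hM] : exists M, forall n, (M <= n)%N ->
    Num.sqrt d%:R * 2^-1 ^+ n <= delta.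
  have : (fun n => Num.sqrt d%:R * 2^-1 ^+ n) @ \oo --> (Num.sqrt d%:R * 0 : R).
    apply: cvgMr; apply: cvg_expr.
    by rewrite ger0_norm// invf_lt1// ltr1n.
  rewrite mulr0 => /cvgrPdist_le/(_ _ delta0)[M _ hM]; exists M => n /hM /=.
  by rewrite sub0r normrN; apply: le_trans; rewrite ler_norm.
have [n Mn hn] := small (e / (D + 1)) M.+1 (divr_gt0 e0 (ltr_wpDl D0 ltr01)).
have [L [sL hL]] := open_paths_enum n x.
have := @premeasure_finite_cover R d s delta A
  (Num.sqrt d%:R * 2^-1 ^+ n) [seq box n (node p) | p <- L] s0.
rewrite hM ?(ltnW Mn)// mulr_ge0 ?exprn_ge0// => /(_ isT) cover.
apply: le_trans (cover _ _) _.
- move=> y /(Acover n (leq_ltn_trans (leq0n M) Mn)) [p [sp op yp]].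
  exists (box n (node p)) => //.
  by apply: map_f; exact: hL.
- by move=> _ /mapP[p _ ->]; exact: box_diam.
rewrite lee_fin size_map powRM ?sqrtr_ge0 ?exprn_ge0// -/D.
rewrite half_expr_powR.
move: hn; rewrite -sL ltr_pdivlMr ?ltr_wpDl// => hn.
rewrite mulrCA mulrC; apply: le_trans (ltW hn).
by apply: ler_wpM2l; [rewrite mulr_ge0// exprn_ge0// powR_ge0|rewrite lerDl].
Qed.

(** Two points of [U] differ by at most one unit of scale [j] in each
    coordinate, so a box meeting [U] has at most 4 possible indices
    there. *)
Lemma count_boxes_meeting U j (L : seq (seq C)) : uniq L ->
  (diam U <= (2^-1 ^+ j)%:E)%E ->
  (count [pred p | (size p == j) && `[< (box j (node p) `&` U) !=set0 >]] L
    <= 4 ^ d)%N.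
Proof.
move=> uL Ud; set Q := [pred p | _].
have [->//|[p0]] : count Q L = 0%N \/ exists p, Q p.
  have [/hasP[p _ Qp]|] := boolP (has Q L); first by right; exists p.
  by rewrite has_count -leqNgt leqn0 => /eqP; left.
move=> /andP[_ /asboolP[u [_ Uu]]].
have [r /andP[r0 rj] Ur] := diam_le_fin (ex_intro _ u Uu) Ud.
(* The indices in direction i lie between m i - 2 and m i + 1. *)
pose m i := Num.floor (2 ^+ j * u 0 i).
pose f p : {ffun 'I_d -> 'I_4} :=
  [ffun i => inord (absz (node p 0 i - (m i - 2))%R)].
have near_u p i : Q p -> 0 <= node p 0 i - (m i - 2) < 4.
  move=> /andP[_ /asboolP[y [yp Uy]]].
  have pj : 0 < 2 ^+ j :> R by rewrite exprn_gt0.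
  have := coord_le_edist u y i.
  move=> /le_trans/(_ (edist_le_diam Ur Uu Uy))/le_trans/(_ rj).
  rewrite exprVn -(ler_pM2l pj) mulfV ?gt_eqF// -{1}(gtr0_norm pj) -normrM.
  rewrite mulrBr ler_norml => /andP[h1 h2].
  have /andP[h3 h4] := yp i.
  have /andP[h5 h6] := floor_itv (2 ^+ j * u 0 i).
  rewrite -/(m i) in h5 h6; rewrite rmorphD/= in h6.
  have g1 : (m i - 2)%:~R < (node p 0 i + 1)%:~R :> R.
    by rewrite rmorphB rmorphD/=; lra.
  have g2 : (node p 0 i)%:~R < (m i + 2)%:~R :> R by rewrite rmorphD/=; lra.
  by move: g1 g2; rewrite !ltr_int; lia.
rewrite -size_filter -(size_map f).
have uf : uniq [seq f p | p <- L & Q p].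
  rewrite map_inj_in_uniq ?filter_uniq// => p q.
  rewrite !mem_filter => /andP[Qp _] /andP[Qq _] /ffunP fpq.
  apply: node_inj.
    by move: Qp Qq => /andP[/eqP-> _] /andP[/eqP-> _].
  apply/rowP => i; have := fpq i; rewrite !ffunE => /(congr1 val).
  have := near_u p i Qp; have := near_u q i Qq => hq hp.
  by rewrite /= !inordK; lia.
move/card_uniqP: uf => <-.
by apply: (leq_trans (max_card _)); rewrite card_ffun !card_ord.
Qed.

(** A set [Pi] of nodes that meets every path of length [n] contains a cut. *)
Lemma cut_cost_le n (rho : nat -> R) (x : seq C -> bool) (Pi : pred (seq C)) :
  (forall j, 0 <= rho j) ->
  (forall p, size p = n -> open_path x p ->
     exists2 i, (i <= n)%N & Pi (take i p)) ->
  cut_cost rho (conf_of n x) <=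
  \sum_(q <- [::] :: @words C n | Pi q) \prod_(j < size q) rho j.
Proof.
elim: n rho x Pi => [|n IH] rho x Pi rho0 cut.
  have [i _ Pii] := cut [::] erefl isT.
  by rewrite big_cons Pii big_nil addr0 big_ord0.
have w0 (q : seq C) : 0 <= \prod_(j < size q) rho j.
  by apply: prodr_ge0 => j _.
rewrite big_cons; case: ifPn => [_|Pi0].
  rewrite big_ord0; apply: (@le_trans _ _ 1).
    by rewrite /= ge_min lexx.
  by rewrite lerDl sumr_ge0.
rewrite [leLHS]/= ge_min; apply/orP; right.
rewrite [in leRHS]big_mkcond big_allpairs_dep big_enum/= big_mkcond/=.
apply: ler_sum => c _; rewrite ffunE/= -big_mkcond/=.
case: (boolP (x [:: c])) => xc; last first.
  by apply: sumr_ge0 => q _; exact: (w0 (c :: q)).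
have -> : \sum_(q <- [::] :: words n | Pi (c :: q))
     \prod_(j < (size q).+1) rho j =
   rho 0 * \sum_(q <- [::] :: words n | Pi (c :: q))
     \prod_(j < size q) rho j.+1.
  rewrite mulr_sumr; apply: eq_bigr => q _.
  by rewrite big_ord_recl; congr (_ * _); apply: eq_bigr.
apply: ler_wpM2l => //.
apply: (IH (fun j => rho j.+1) _ (fun q => Pi (c :: q))) => // p sp op.
have [i i1] : exists2 i, (i <= n.+1)%N & Pi (take i (c :: p)).
  by apply: cut; rewrite /= ?sp ?xc.
case: i i1 => [_|i i1] /=; first by rewrite (negbTE Pi0).
by exists i.
Qed.

(** Each covering set [U n] is replaced by the boxes meeting it at a scale
    comparable to its diameter; there are at most [4 ^ d] of them.  Every
    infinite branch of the tree leads to a point of [A], hence runs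
    through one of these boxes, and by Konig's lemma the boxes already
    cut the tree at some finite level.  The products of [rho] are bounded
    up to the constant [D] because the thinning starts late, and [s] is
    separate from [s'] so that one thinning rate settles all exponents up
    to [s']. *)
Lemma cut_cost_small_of_null (x : seq C -> bool) A (rho : nat -> R)
    (s s' D e : R) :
  (forall f : nat -> C, (forall n, open_path x (mkseq f n)) ->
   forall y, (forall n, box n (node (mkseq f n)) y) -> A y) ->
  hausdorff_measure s A = 0%E -> 0 <= s <= s' -> 0 < s' ->
  (forall j, 0 <= rho j) -> 0 < D ->
  (forall n, \prod_(j < n) rho j <= D * (2 `^ (- s')) ^+ n) ->
  0 < e -> exists n, cut_cost rho (conf_of n x) < e.
Proof.
move=> Abranch A0 /andP[s0 ss'] s'0 rho0 D0 rhoD e0.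
(* The factor 2 leaves room for both the sum over the cover and the sum of the
   errors made in choosing the scales. *)
pose E := e / (2 * D * 4 ^+ d).
have E0 : 0 < E by rewrite divr_gt0// !mulr_gt0// exprn_gt0.
have a0 : 0 < 2 `^ s' :> R by rewrite powR_gt0.
have [U [AU U1 sumU]] := hausdorff_measure0_cover A0 (divr_gt0 E0 a0).
(* The scale attached to each covering set. *)
(* The errors add up to at most E. *)
have /choice[j hj] : forall n, exists j, U n !=set0 ->
    (diam (U n) <= (2^-1 ^+ j)%:E)%E /\
    (((2 `^ (- s')) ^+ j)%:E <=
      (2 `^ s')%:E * diam_pow s (U n) + (E * 2^-1 ^+ n.+1)%:E)%E.
  move=> n; have [Un|?] := pselect (U n !=set0); last by exists 0%N.
  have [r /andP[r0 r1] Ur] := diam_le_fin Un (U1 n).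
  have En : 0 < E * 2^-1 ^+ n.+1 by rewrite mulr_gt0// exprn_gt0// invr_gt0.
  have [|k [rk hk]] := @dyadic_scale R r s' _ _ s'0 En; first by rewrite r0.
  exists k => _; rewrite (diam_powE s Un Ur) Ur lee_fin; split => //.
  rewrite -EFinM -EFinD lee_fin (le_trans hk)// lerD2r ler_pM2l//.
  have [->|rn0] := eqVneq r 0; first by rewrite powR0 ?gt_eqF// powR_ge0.
  by apply: ger_powR => //; rewrite r1 andbT lt_neqAle r0 andbT eq_sym.
pose Q n p := (size p == j n) && `[< (box (j n) (node p) `&` U n) !=set0 >].
pose Pi p := `[< exists n, Q n p >].
have [N cut] : exists N, forall p, size p = N -> open_path x p ->
    exists2 i, (i <= N)%N & Pi (take i p).
  apply: contrapT => nocut.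
  pose G p := open_path x p /\ forall i, (i <= size p)%N -> ~ Pi (take i p).
  have [|n|f Gf] := @konig _ G.
  - move=> p c [+ h]; rewrite open_path_rcons => /andP[op _]; split => // i ip.
    have := h i; rewrite size_rcons -cats1 takel_cat//; apply.
    exact: leqW.
  - apply: contrapT => h; apply: nocut; exists n => p sp op.
    apply: contrapT => h'; apply: h; exists p => //; split=> // i ip Pii.
    by apply: h'; exists i => //; rewrite -sp.
  have [y hy] := @branch_point R d f.
  have /AU[n _ Uny] : A y by apply: Abranch hy => n; exact: (Gf n).1.
  have := (Gf (j n)).2 (j n); rewrite size_mkseq leqnn => /(_ isT); apply.
  rewrite take_oversize ?size_mkseq//; apply/asboolP; exists n.
  rewrite /Q size_mkseq eqxx; apply/asboolP; exists y; split => //.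
exists N; apply: le_lt_trans (cut_cost_le rho0 cut) _.
set L := [::] :: words N.
have uL : uniq L by rewrite /L cons_uniq words_neq0 uniq_words.
have /choice[nu hnu] : forall q, exists n, Pi q -> Q n q.
  move=> q; have [/asboolP[n Qn]|h] := boolP (Pi q); first by exists n.
  by exists 0%N.
have sumQ n : \sum_(q <- L) (Q n q)%:R = (count (Q n) L)%:R :> R.
  rewrite -sum1_count natr_sum [RHS]big_mkcond; apply: eq_bigr => q _.
  by case: (Q n q).
pose M := (\max_(q <- L) nu q).+1.
have q0 : 0 < 2 `^ (- s') :> R by rewrite powR_gt0.
apply: (@le_lt_trans _ _
  (\sum_(0 <= n < M) D * ((2 `^ (- s')) ^+ j n * (count (Q n) L)%:R))).
  apply: (@le_trans _ _ (\sum_(q <- L) \sum_(0 <= n < M)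
     (Q n q)%:R * (D * (2 `^ (- s')) ^+ j n))).
    rewrite big_mkcond big_seq [leRHS]big_seq; apply: ler_sum => q qL.
    have t0 n : 0 <= (Q n q)%:R * (D * (2 `^ (- s')) ^+ j n).
      by rewrite mulr_ge0 ?mulr_ge0 ?exprn_ge0 ?powR_ge0 ?(ltW D0).
    case: ifPn => [/hnu Qq|_]; last by apply: sumr_ge0.
    have nuM : (0 <= nu q < M)%N by rewrite ltnS leq_bigmax_seq.
    rewrite (bigD1_seq (nu q)) ?mem_index_iota ?iota_uniq//= Qq mul1r.
    apply: (le_trans (rhoD _)).
    by have /andP[/eqP -> _] := Qq; rewrite lerDl sumr_ge0.
  rewrite exchange_big/=; apply: ler_sum => n _.
  rewrite -mulr_suml mulrC mulrA; apply: ler_wpM2l.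
    by rewrite mulr_ge0 ?ltW ?exprn_gt0.
  by rewrite sumQ; exact: lexx.
have countQ n : (U n !=set0 -> (count (Q n) L <= 4 ^ d)%N) /\
    (~ (U n !=set0) -> count (Q n) L = 0%N).
  split=> [Un|nU].
    by apply: count_boxes_meeting => //; exact: (hj n Un).1.
  rewrite -(count_pred0 L); apply: eq_count => q; apply/negbTE/negP.
  by move=> /andP[_ /asboolP[y [_ Uy]]]; apply: nU; exists y.
pose u n := fine (diam_pow s (U n)).
have uE n : diam_pow s (U n) = (u n)%:E.
  rewrite /u fineK// ge0_fin_numE ?diam_pow_ge0//.
  apply: le_lt_trans (diam_pow_le s0 ler01 (U1 n)) _; exact: ltry.
have u0 n : 0 <= u n by rewrite fine_ge0// diam_pow_ge0.
have hterm n : (2 `^ (- s')) ^+ j n * (count (Q n) L)%:R <=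
    4 ^+ d * (2 `^ s' * u n + E * 2^-1 ^+ n.+1).
  have b0 : 0 <= 2 `^ s' * u n + E * 2^-1 ^+ n.+1.
    by rewrite addr_ge0// mulr_ge0// ?ltW// exprn_gt0// invr_gt0.
  have [Un|nU] := pselect (U n !=set0); last first.
    by rewrite (countQ n).2// mulr0 mulr_ge0// exprn_ge0.
  rewrite mulrC; apply: ler_pM => //.
    by rewrite -natrX ler_nat (countQ n).1.
  by have := (hj n Un).2; rewrite uE -EFinM -EFinD lee_fin.
apply: (@le_lt_trans _ _ (D * (4 ^+ d *
   (2 `^ s' * \sum_(0 <= n < M) u n + E * \sum_(0 <= n < M) 2^-1 ^+ n.+1)))).
  rewrite -mulr_sumr ler_pM2l// 2!mulr_sumr -big_split/= mulr_sumr.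
  by apply: ler_sum => n _; exact: hterm.
have sumu : \sum_(0 <= n < M) u n < E / 2 `^ s'.
  rewrite -lte_fin -sumEFin; apply: le_lt_trans sumU.
  rewrite (eq_bigr (fun n => diam_pow s (U n))) => [|n _]; last by rewrite uE.
  by apply: nneseries_lim_ge => n _ _; exact: diam_pow_ge0.
have geo m : \sum_(0 <= n < m) 2^-1 ^+ n.+1 = 1 - 2^-1 ^+ m :> R.
  elim: m => [|m IH]; first by rewrite big_nil expr0 subrr.
  by rewrite big_nat_recr//= IH !exprS; lra.
have geo1 : \sum_(0 <= n < M) 2^-1 ^+ n.+1 <= 1 :> R.
  by rewrite geo gerBl exprn_ge0// invr_ge0.
apply: (@lt_le_trans _ _ (D * (4 ^+ d * (E + E)))).
  rewrite !ltr_pM2l ?exprn_gt0//; apply: ltr_leD.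
    by rewrite mulrC -ltr_pdivlMr.
  by rewrite ler_piMr// ltW.
rewrite /E le_eqVlt; apply/orP; left; apply/eqP.
have D0' : D != 0 by rewrite gt_eqF.
have d0 : 4 ^+ d != 0 :> R by rewrite expf_neq0.
by field; rewrite D0' d0.
Qed.

End CoveringTrees.

(** * Independent uniform variables and their threshold states *)

Section ProbabilityTools.
Context {disp : measure_display} {T : measurableType disp} {R : realType}.
Variable P : probability T R.

(** The intersection of the covering events is a measurable null set. *)
Lemma negligible_small (A : set T) :
  (forall e : R, 0 < e ->
     exists B, [/\ measurable B, A `<=` B & (P B <= e%:E)%E]) ->
  P.-negligible A.
Proof.
move=> h.
have /choice[B hB] : forall n : nat, exists B, [/\ measurable B, A `<=` B &
    (P B <= (n.+1%:R^-1)%:E)%E].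
  by move=> n; apply: h; rewrite invr_gt0.
have mB : measurable (\bigcap_n B n).
  by apply: bigcap_measurableType => n _; have [] := hB n.
exists (\bigcap_n B n); split => //; last first.
  by move=> x Ax n _; have [_ + _] := hB n; exact.
apply/eqP; rewrite eq_le measure_ge0 andbT; apply/lee_addgt0Pr => e e0.
rewrite add0e; have [n hn] : exists n : nat, n.+1%:R^-1 < e.
  exists (Num.truncn e^-1); rewrite invf_plt ?posrE//.
  exact: truncnS_gt.
have [mBn _ PBn] := hB n.
apply: (@le_trans _ _ (P (B n))); last by rewrite (le_trans PBn)// lee_fin ltW.
by apply: le_measure; rewrite ?inE// => x; exact.
Qed.

Lemma independent_RVs_reindex (I J : choiceType) (X : I -> {RV P >-> R})
    (f : J -> I) :
  injective f -> independent_RVs X -> independent_RVs (fun j => X (f j)).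
Proof.
move=> f_inj indX s B us mB.
have [->|[j0 _]] : s = [::] \/ exists j0, j0 \in s.
- by case: (s) => [|j0 s']; [left|right; exists j0; rewrite mem_head].
- by rewrite big_nil set_nil bigcap_set0 probability_setT.
pose B' i := B (nth j0 s (index i (map f s))).
have fB j : j \in s -> B j = B' (f j).
  by move=> js; rewrite /B' index_map// nth_index.
have := indX (map f s) B'; rewrite map_inj_uniq// => /(_ us (fun _ => mB _)) e.
transitivity (\prod_(i <- map f s) P (X i @^-1` B' i))%E.
  rewrite -e; congr (P _); apply/seteqP; split=> w /= h i /=.
    by move=> /mapP[j js ->]; rewrite -fB//; exact: h.
  by move=> js; rewrite /preimage/= (fB i js); apply: h; exact: map_f.
rewrite big_map big_seq [RHS]big_seq; apply: eq_bigr => j js.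
by rewrite -fB.
Qed.

Lemma uniform_prob_lt (b : R) : 0 <= b <= 1 ->
  uniform_prob (@ltr01 R) [set r | r < b] = b%:E.
Proof.
move=> /andP[b0 b1]; rewrite /uniform_prob integral_uniform_pdf.
have -> : [set r | r < b] `&` `[0, 1] = `[0, b[%classic :> set R.
  apply/seteqP; split=> r /=; rewrite !in_itv/=; first by move=> [-> /andP[->]].
  by move=> /andP[-> rb]; rewrite rb/= ltW// (lt_le_trans rb).
rewrite (eq_integral (cst 1%E)) => [|r]; last first.
  rewrite inE/= in_itv/= => /andP[r0 rb].
  by rewrite /uniform_pdf r0 (ltW (lt_le_trans rb b1)) subr0 invr1.
rewrite integral_cst// mul1e [LHS]lebesgue_measure_itv/= lte_fin.
by case: ltgtP b0 => // [_ _|<-//]; rewrite sube0.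
Qed.

End ProbabilityTools.

Section PercolationLaw.
Context {disp : measure_display} {T : measurableType disp} {R : realType}.
Context {P : probability T R} {C : finType}.
Variables (b b' : R) (X : seq C -> {RV P >-> R}).
Hypothesis b01 : 0 <= b <= 1.
Hypothesis b'b : 0 <= b' <= b.
Hypothesis X_indep : independent_RVs X.
Hypothesis X_unif : forall p, uniform01 (X p).

Definition thresholds (r : R) : bool * bool := (r < b, r < b').

Definition threshold_law (k : bool * bool) : R :=
  fine (uniform_prob (@ltr01 R) [set r | thresholds r = k]).

Definition states p w := thresholds (X p w).

Lemma measurable_thresholds k : measurable [set r | thresholds r = k].
Proof.
have m (c : R) : measurable [set r : R | r < c].
  have -> : [set r | r < c] = `]-oo, c[%classic :> set R.
    by apply/seteqP; split=> r /=; rewrite in_itv.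
  exact: measurable_itv.
have m' (c : R) (u : bool) : measurable [set r : R | (r < c) = u].
  case: u; first exact: m.
  have -> : [set r | (r < c) = false] = ~` [set r | r < c].
    by apply/seteqP; split=> r /=; [move=> ->|move/negP/negbTE].
  exact: measurableC.
case: k => u v; have -> : [set r | thresholds r = (u, v)] =
    [set r | (r < b) = u] `&` [set r | (r < b') = v].
  by apply/seteqP; split=> r /=; rewrite /thresholds => -[-> ->].
exact: measurableI.
Qed.

Lemma threshold_law_fin k :
  uniform_prob (@ltr01 R) [set r | thresholds r = k] = (threshold_law k)%:E.
Proof.
rewrite /threshold_law fineK// fin_num_measure//.
exact: measurable_thresholds.
Qed.

Lemma threshold_law_ge0 k : 0 <= threshold_law k.
Proof. by rewrite fine_ge0. Qed.

Lemma sum_threshold_law (A : pred (bool * bool)) :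
  (\sum_(k | A k) threshold_law k)%:E =
  uniform_prob (@ltr01 R) [set r | A (thresholds r)].
Proof.
apply/esym/measure_finite_valued; first exact: measurable_thresholds.
exact: threshold_law_fin.
Qed.

Lemma threshold_law1 : \sum_k threshold_law k = 1.
Proof.
apply: EFin_inj; rewrite (sum_threshold_law predT).
rewrite -[RHS](@probability_setT _ _ _ (uniform_prob (@ltr01 R))).
by congr (uniform_prob _ _); apply/seteqP.
Qed.

Lemma threshold_law_fst : \sum_(k | k.1) threshold_law k = b.
Proof.
by apply: EFin_inj; rewrite (sum_threshold_law fst) -(uniform_prob_lt b01).
Qed.

Lemma threshold_law_snd : \sum_(k | k.1 && k.2) threshold_law k = b'.
Proof.
have /andP[b'0 hb'] := b'b; have /andP[b0 b1] := b01.
have b'01 : 0 <= b' <= 1 by rewrite b'0 (le_trans hb').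
apply: EFin_inj; rewrite (sum_threshold_law (fun k => k.1 && k.2)).
rewrite -(uniform_prob_lt b'01); congr (uniform_prob _ _).
apply/seteqP; split=> r /=; first by case/andP.
by move=> rb'; rewrite rb' andbT (lt_le_trans rb').
Qed.

Lemma measurable_states p k : measurable [set w | states p w = k].
Proof.
rewrite (_ : [set _ | _] = X p @^-1` [set r | thresholds r = k])//.
by rewrite -[X in measurable X]setTI; apply: measurable_funP => //;
  exact: measurable_thresholds.
Qed.

Lemma states_indep (s : seq (seq C)) (f : seq C -> bool * bool) : uniq s ->
  P (\bigcap_(p in [set` s]) [set w | states p w = f p]) =
  (\prod_(p <- s) threshold_law (f p))%:E.
Proof.
move=> us; have := X_indep us (fun p => measurable_thresholds (f p)).
rewrite /= => ->; rewrite -prodEFin; apply: eq_bigr => p _.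
rewrite -threshold_law_fin -(X_unif p)//; exact: measurable_thresholds.
Qed.

End PercolationLaw.

(** * Almost sure behaviour of random trees *)

Section ConfMonotone.
Context {R : realType} {C K : finType}.

Lemma alive_conf_ofS n (b : nat -> pred K) (z : seq C -> K) :
  alive b (conf_of n.+1 z) -> alive b (conf_of n z).
Proof.
elim: n b z => // n IH b z /existsP[c]; rewrite ffunE => /andP[bc h].
by apply/existsP; exists c; rewrite ffunE bc; exact: IH h.
Qed.

Lemma cut_cost_conf_ofS n (rho : nat -> R) (x : seq C -> bool) :
  (forall j, 0 <= rho j) ->
  cut_cost rho (conf_of n.+1 x) <= cut_cost rho (conf_of n x).
Proof.
elim: n rho x => [|n IH] rho x rho0; first by rewrite /= ge_min lexx.
rewrite [leLHS]/= [leRHS]/= le_min ge_min lexx/= ge_min; apply/orP; right.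
rewrite big_mkcond [leRHS]big_mkcond/=; apply: ler_sum => c _.
rewrite !ffunE; case: (x [:: c]) => //; apply: ler_wpM2l => //.
exact: (IH (fun j => rho j.+1)).
Qed.

Lemma conf_map_of n (a : pred K) (z : seq C -> K) :
  conf_map a (conf_of n z) = conf_of n (fun p => a (z p)).
Proof.
elim: n z => // n IH z; apply/ffunP => c; rewrite !ffunE/=.
by congr (_, _); exact: IH.
Qed.

Lemma width_conf_of n (a : pred K) (z : seq C -> K) :
  width a (conf_of n z) = width id (conf_of n (fun p => a (z p))) :> R.
Proof.
elim: n z => // n IH z; apply: eq_bigr => c _; rewrite !ffunE/=.
by congr (_ * _); exact: IH.
Qed.

End ConfMonotone.

Section RandomTrees.
Context {R : realType} {disp : measure_display} {T : measurableType disp}.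
Context {C K : finType}.
Variables (P : probability T R) (wt : K -> R) (Z : seq C -> T -> K).
Hypothesis wt0 : forall k, 0 <= wt k.
Hypothesis wt1 : \sum_k wt k = 1.
Hypothesis mZ : forall p k, measurable [set w | Z p w = k].
Hypothesis Z_indep : forall (s : seq (seq C)) (f : seq C -> K), uniq s ->
  P (\bigcap_(p in [set` s]) [set w | Z p w = f p]) =
  (\prod_(p <- s) wt (f p))%:E.

Definition extinction (b : nat -> pred K) : set T :=
  \bigcup_n [set w | ~~ alive b (conf_of n (Z^~ w))].

Lemma measurable_extinction b : measurable (extinction b).
Proof.
apply: bigcupT_measurable => n.
exact: (measurable_conf_event mZ (fun g => ~~ alive b g)).
Qed.

Lemma not_extinction b w :
  ~ extinction b w -> forall n, alive b (conf_of n (Z^~ w)).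
Proof. by move=> h n; apply/negPn/negP => hn; apply: h; exists n. Qed.

Lemma extinction_cvg b :
  (extinction_prob (C := C) wt n b)%:E @[n --> \oo] --> P (extinction b).
Proof.
have -> : (fun n => (extinction_prob (C := C) wt n b)%:E) =
    P \o (fun n => [set w | ~~ alive b (conf_of n (Z^~ w))]).
  apply/funext => n /=.
  rewrite (conf_event_probability mZ Z_indep (fun g => ~~ alive b g)).
  by rewrite extinction_probE.
apply: nondecreasing_cvg_mu; last 2 first.
- exact: measurable_extinction.
- apply/nondecreasing_seqP => n; apply/subsetPset => w /=.
  exact/contra/alive_conf_ofS.
- move=> n; exact: (measurable_conf_event mZ (fun g => ~~ alive b g)).
Qed.

Lemma extinction_eq b l :
  extinction_prob (C := C) wt n b @[n --> \oo] --> l -> P (extinction b) = l%:E.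
Proof.
move=> cl; rewrite -(cvg_lim _ (@extinction_cvg b))//; apply/cvg_lim => //.
by apply/fine_cvgP; split; [exact: nearW|exact: cl].
Qed.

Lemma extinction_le b l :
  (forall n, extinction_prob (C := C) wt n b <= l) ->
  (P (extinction b) <= l%:E)%E.
Proof.
move=> hl; have cl := @extinction_cvg b.
rewrite -(cvg_lim _ cl)//; apply: lime_le; first exact: cvgP cl.
by apply: nearW => n; rewrite lee_fin.
Qed.

(** Cut costs decrease with the level, so the events that a cut cheaper than
    [e] exists before level [n] increase.  Each of them meets the
    survival event with probability at most [e], and so does their union. *)
Lemma thinned_survival_null (a : pred K) (b : nat -> pred K)
    (rho : nat -> R) :
  (forall j, 0 <= rho j) ->
  (forall j k, b j k -> a k) ->
  (forall j, \sum_(k | b j k) wt k <= rho j * \sum_(k | a k) wt k) ->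
  P.-negligible [set w | (forall n, alive b (conf_of n (Z^~ w))) /\
    forall e, 0 < e ->
      exists n, cut_cost rho (conf_of n (fun p => a (Z p w))) < e].
Proof.
move=> rho0 ba hb; apply: negligible_small => e e0.
pose cheap n := [set w | cut_cost rho (conf_map a (conf_of n (Z^~ w))) < e].
have mcheap n : measurable (cheap n).
  exact: (measurable_conf_event mZ (fun g => cut_cost rho (conf_map a g) < e)).
pose F n := cheap n `\` extinction b.
have mF n : measurable (F n).
  by apply: measurableD => //; exact: measurable_extinction.
have mcF : measurable (\bigcup_n F n) by exact: bigcupT_measurable.
exists (\bigcup_n F n); split => //.
- move=> w [al /(_ _ e0)[n hn]]; exists n => //; split.
    by rewrite /cheap/= conf_map_of.
  by move=> [m _ /=]; rewrite al.
- have cF : P \o F @ \oo --> P (\bigcup_n F n).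
    apply: nondecreasing_cvg_mu => //; apply/nondecreasing_seqP => n.
    apply/subsetPset => w [hw nw]; split => //.
    have := cut_cost_conf_ofS n (fun p => a (Z p w)) rho0.
    by rewrite -!conf_map_of => h; exact: le_lt_trans h hw.
  rewrite -(cvg_lim _ cF)//; apply: lime_le; first exact: cvgP cF.
  apply: nearW => n.
  have mA : measurable [set w |
      (cut_cost rho (conf_map a (conf_of n (Z^~ w))) < e) &&
      alive b (conf_of n (Z^~ w))].
    exact: (measurable_conf_event mZ
      (fun g => (cut_cost rho (conf_map a g) < e) && alive b g)).
  apply: (@le_trans _ _ (P [set w |
      (cut_cost rho (conf_map a (conf_of n (Z^~ w))) < e) &&
      alive b (conf_of n (Z^~ w))])).
    apply: le_measure; [by rewrite inE; exact: mF|by rewrite inE|].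
    by move=> w [hw nw]; apply/andP; split => //; exact: not_extinction.
  rewrite (conf_event_probability mZ Z_indep
    (fun g => (cut_cost rho (conf_map a g) < e) && alive b g)) lee_fin.
  by apply: percolation_lt_cut_cost => //; exact: ltW.
Qed.

(** Markov's inequality. *)
Lemma width_markov (a : pred K) n (e l : R) : 0 < e -> 0 <= l ->
  (P [set w | e <= width a (conf_of n (Z^~ w)) * l]%R <=
   ((#|C|%:R * \sum_(k | a k) wt k) ^+ n * l / e)%:E)%E.
Proof.
move=> e0 l0.
rewrite (conf_event_probability mZ Z_indep (fun g => e <= width a g * l)).
rewrite lee_fin.
rewrite -(expected_width wt1) ler_pdivlMr// !mulr_suml big_mkcond/=.
apply: ler_sum => g _; have w0 := weight_ge0 wt0 g.
case: ifPn => h; first by rewrite -mulrA; apply: ler_wpM2l.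
by rewrite !mulr_ge0// width_ge0.
Qed.

(** If the mean offspring number times [q] is below 1, the expectation of
    [width * q ^ n] tends to 0; by Markov's inequality the events that it
    exceeds [e] at all levels beyond [M] have probability 0. *)
Lemma width_small_ae (a : pred K) (q : R) : 0 <= q ->
  #|C|%:R * (\sum_(k | a k) wt k) * q < 1 ->
  {ae P, forall w, forall e M, 0 < e -> exists2 n, (M <= n)%N &
    width a (conf_of n (Z^~ w)) * q ^+ n < e}.
Proof.
move=> q0; set m := #|C|%:R * _ => mq1.
have m0 : 0 <= m.
  by apply: mulr_ge0; [exact: ler0n|apply: sumr_ge0 => k _; exact: wt0].
suff : {ae P, forall w, forall k M : nat, exists2 n, (M <= n)%N &
    width a (conf_of n (Z^~ w)) * q ^+ n < k.+1%:R^-1}.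
  apply: filterS => w h e M e0.
  have [n Mn hn] := h (Num.truncn e^-1) M; exists n => //.
  by apply: (lt_trans hn); rewrite invf_plt ?posrE//; exact: truncnS_gt.
apply: ae_foralln => k; apply: ae_foralln => M.
apply: (@negligible_small _ _ _ P) => e e0.
have k0 : 0 < k.+1%:R^-1 :> R by rewrite invr_gt0.
have cv : (fun n => (m * q) ^+ n * k.+1%:R) @ \oo --> (0 * k.+1%:R : R).
  by apply: cvgMl; apply: cvg_expr; rewrite (ger0_norm (mulr_ge0 m0 q0)).
move: cv; rewrite mul0r => /cvgrPdist_le/(_ _ e0)[N _ hN].
exists [set w | k.+1%:R^-1 <=
  width a (conf_of (maxn M N) (Z^~ w)) * q ^+ (maxn M N)]; split.
- exact: (measurable_conf_event mZ
    (fun g => k.+1%:R^-1 <= width a g * q ^+ (maxn M N))).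
- move=> w /= nw; rewrite leNgt; apply/negP => h; apply: nw.
  by exists (maxn M N) => //; exact: leq_maxl.
- apply: (le_trans (width_markov _ _ k0 (exprn_ge0 _ q0))).
  rewrite lee_fin -exprMn invrK; apply: le_trans (hN _ (leq_maxr M N)).
  by rewrite /= sub0r normrN ler_norm.
Qed.

End RandomTrees.

(** * The random set *)

Section TauGeometry.
Context {R : realType} {d : nat}.
Context {disp : measure_display} {Omega : measurableType disp}.
Context {P : probability Omega R}.
Variables (beta : R) (t : nat -> 'rV[int]_d -> {RV P >-> R}) (w : Omega).
Local Notation C := {ffun 'I_d -> bool}.

Lemma tau_sub_boxes n : (0 < n)%N -> tau beta t w `<=` [set y | exists p,
  [/\ size p = n, open_path (retained beta t w) p & box n (node p) y]].
Proof.
move=> n0 y /(_ n n0)[k /= Tk yk]; have [p [sp np op]] := level_node Tk.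
by exists p; rewrite np; split => //; exact: closure_cube_sub.
Qed.

Lemma branch_in_tau (f : nat -> C) y :
  (forall n, open_path (retained beta t w) (mkseq f n)) ->
  (forall n, box n (node (mkseq f n)) y) -> tau beta t w y.
Proof.
move=> of_ fy n _; exists (node (mkseq f n)).
  by have /level_nodeP := of_ n; rewrite size_mkseq.
apply: box_sub_closure_cube (fy n) => i.
by have := node_itv (mkseq f n) i; rewrite size_mkseq.
Qed.

(** A tree with nodes at all levels has an infinite branch, and the boxes
    along it share a point. *)
Lemma tau_eq0 : tau beta t w = set0 <->
  exists n, forall p, size p = n -> ~ open_path (retained beta t w) p.
Proof.
split=> [tau0|[n hn]].
  apply: contrapT => h.
  have [p c|n|f Gf] := @konig C (open_path (retained beta t w)).
  - by rewrite open_path_rcons => /andP[].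
  - apply: contrapT => h'; apply: h; exists n => p sp op; apply: h'.
    by exists p.
  - have [y hy] := @branch_point R d f.
    by have := branch_in_tau Gf hy; rewrite tau0.
apply/seteqP; split=> // y /(tau_sub_boxes (ltn0Sn n))[p [sp op _]].
case/lastP: p sp op => // p c; rewrite size_rcons open_path_rcons => -[sp].
by move=> /andP[/(hn p sp)].
Qed.

End TauGeometry.

Section DimensionCriterion.
Context {R : realType} {d : nat}.
Implicit Types (A : set 'rV[R]_d) (g : R).

Lemma hausdorff_dim0 : hausdorff_dim (@set0 'rV[R]_d) = 0%E.
Proof.
apply/eqP; rewrite eq_le; apply/andP; split; last first.
  by apply: le_ereal_inf_tmp => _ [s [/= s0 _] <-]; rewrite lee_fin.
apply: ereal_inf_lbound; exists 0 => //; split=> //.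
apply: hausdorff_measure_eq0 => delta e delta0 e0.
have := @premeasure_finite_cover R d 0 delta set0 0 [::] (lexx 0).
rewrite lexx ltW//= mul0r => /(_ isT) h.
by apply: (le_trans (h _ _)) => //; rewrite lee_fin ltW.
Qed.

(** The dimension is the infimum of the exponents of measure zero, so
    exponents arbitrarily close to [g] from above suffice for the upper
    bound. *)
Lemma hausdorff_dim_eq A g : 0 < g ->
  (forall e, 0 < e ->
     exists2 s, g <= s <= g + e & hausdorff_measure s A = 0%E) ->
  (forall s, 0 <= s < g -> hausdorff_measure s A <> 0%E) ->
  hausdorff_dim A = g%:E.
Proof.
move=> g0 up lo; apply/eqP; rewrite eq_le; apply/andP; split.
  apply/lee_addgt0Pr => e /up[s /andP[gs sge] sA].
  apply: (@le_trans _ _ s%:E); last by rewrite -EFinD lee_fin.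
  apply: ereal_inf_lbound; exists s => //; split => //.
  by apply: le_trans gs; exact: ltW.
apply: le_ereal_inf_tmp => _ [s [/= s0 sA] <-]; rewrite lee_fin leNgt.
by apply/negP => sg; apply: (lo s) => //; rewrite s0.
Qed.

End DimensionCriterion.

(** * Fractal percolation *)

Section FractalPercolation.
Context {R : realType} {d : nat}.
Context {disp : measure_display} {Omega : measurableType disp}.
Context {P : probability Omega R}.
Variables (gamma beta : R) (t : nat -> 'rV[int]_d -> {RV P >-> R}).
Hypothesis d_gt0 : (1 <= d)%N.
Hypothesis gamma_le : gamma <= d%:R.
Hypothesis betaE : beta = 2 `^ (gamma - d%:R).
Hypothesis t_indep : independent_RVs (fun n : nat * 'rV[int]_d => t n.1 n.2).
Hypothesis t_unif : forall j k, uniform01 (t j k).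
Local Notation C := {ffun 'I_d -> bool}.

Let X (p : seq C) : {RV P >-> R} := t (size p) (node p).

Let X_indep : independent_RVs X.
Proof.
apply: (@independent_RVs_reindex _ _ _ _ _ _ _
  (fun p : seq C => (size p, node p)) _ t_indep).
by move=> p q [spq npq]; exact: node_inj.
Qed.

Let X_unif p : uniform01 (X p). Proof. exact: t_unif. Qed.

Let beta_gt0 : 0 < beta. Proof. by rewrite betaE powR_gt0. Qed.

Let beta_le1 : beta <= 1.
Proof.
rewrite betaE -[leRHS](powRr0 (2 : R)); apply: ler_powR; first by rewrite ler1n.
by rewrite subr_le0.
Qed.

Let beta01 : 0 <= beta <= 1. Proof. by rewrite beta_le1 ltW. Qed.

Let card_C : #|C| = (2 ^ d)%N.
Proof. by rewrite card_ffun card_bool card_ord. Qed.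

Let C_gt1 : (1 < #|C|)%N.
Proof.
by rewrite card_C; case: d d_gt0 => // n _; rewrite expnS leq_pmulr// expn_gt0.
Qed.

Let offspring_mean : #|C|%:R * beta = 2 `^ gamma :> R.
Proof.
rewrite card_C natrX -powR_mulrn// betaE -powRD; first by rewrite addrC subrK.
by rewrite pnatr_eq0 implybT.
Qed.

Section Thinning.
(* The conditional probability that thinning keeps a node of the tree. *)
Variable lambda : R.
Hypothesis lambda01 : 0 < lambda <= 1.

Let beta' := beta * lambda.

Let beta'b : 0 <= beta' <= beta.
Proof.
case/andP: lambda01 => l0 l1; rewrite (mulr_ge0 (ltW beta_gt0) (ltW l0))/=.
by rewrite ler_piMr// ltW.
Qed.

Let Z := states beta beta' X.
Let wt := threshold_law beta beta'.
Let wt0 k : 0 <= wt k. Proof. exact: threshold_law_ge0. Qed.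
Let wt1 : \sum_k wt k = 1. Proof. exact: threshold_law1. Qed.
Let mZ p k : measurable [set w | Z p w = k].
Proof. exact: measurable_states. Qed.
Let Z_indep : forall (s : seq (seq C)) (f : seq C -> bool * bool), uniq s ->
  P (\bigcap_(p in [set` s]) [set w | Z p w = f p]) =
  (\prod_(p <- s) wt (f p))%:E.
Proof. by move=> s f us; exact: states_indep. Qed.
Let wt_fst : \sum_(k | k.1) wt k = beta. Proof. exact: threshold_law_fst. Qed.
Let wt_snd : \sum_(k | k.1 && k.2) wt k = beta'.
Proof. exact: threshold_law_snd. Qed.

Let whole : nat -> pred (bool * bool) := fun=> fst.

Lemma tau_eq0_extinction :
  [set w | tau beta t w = set0] = extinction Z whole.
Proof.
apply/seteqP; split=> w /=.
  move=> /tau_eq0[n hn]; exists n => //=; apply/alive_conf_ofP => -[p sp op].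
  exact: (hn p sp).
move=> [n _ /= /alive_conf_ofP hn]; apply/tau_eq0; exists n => p sp op.
by apply: hn; exists p.
Qed.

Lemma extinction_prob_whole n :
  extinction_prob (C := C) wt n whole = iter n (pgf #|C| beta) 0.
Proof. by elim: n => //= n <-; rewrite wt_fst. Qed.

Lemma tau_empty_probability l :
  iter n (pgf #|C| beta) 0 @[n --> \oo] --> l ->
  measurable [set w | tau beta t w = set0] /\
  P [set w | tau beta t w = set0] = l%:E.
Proof.
move=> cl; rewrite tau_eq0_extinction; split.
  exact: measurable_extinction mZ _.
apply: (extinction_eq wt1 mZ Z_indep).
rewrite (_ : (fun n => _) = fun n => iter n (pgf #|C| beta) 0)//.
by apply/funext => n; exact: extinction_prob_whole.
Qed.

Lemma hausdorff_measure_tau_eq0_ae s : 0 <= s -> lambda = 2 `^ (- s) ->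
  gamma < s -> {ae P, forall w, hausdorff_measure s (tau beta t w) = 0%E}.
Proof.
move=> s0 lE gs; case/andP: lambda01 => l0 l1.
have h : #|C|%:R * (\sum_(k | k.1) wt k) * lambda < 1.
  rewrite wt_fst offspring_mean lE -powRD ?pnatr_eq0 ?implybT//.
  by rewrite -[gamma - s]opprB powR2N_lt1// subr_gt0.
have := width_small_ae wt0 wt1 mZ Z_indep (ltW l0) h.
apply: filterS => w hw; apply: (@hausdorff_measure_eq0_width R d
  (retained beta t w)) => //.
  exact: tau_sub_boxes.
by move=> e M e0; have [n Mn hn] := hw e M e0; exists n; rewrite // -lE;
  rewrite width_conf_of in hn.
Qed.

(* Thinning sets in after level m. *)
Let mixed m : nat -> pred (bool * bool) :=
  fun j k => if (j < m)%N then k.1 else k.1 && k.2.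

(** Beyond level [m] the mixed tree is a Galton-Watson tree with parameter
    [beta'], whose extinction probabilities stay below the fixed point
    [p']. *)
Lemma extinction_prob_mixed p' m n : 0 <= p' -> pgf #|C| beta' p' = p' ->
  extinction_prob (C := C) wt n (mixed m) <= iter m (pgf #|C| beta) p'.
Proof.
move=> p'0 fp'.
have b'01 : 0 <= beta' <= 1.
  by case/andP: beta'b => -> h /=; exact: le_trans h _.
have ext0 k b : 0 <= extinction_prob (C := C) wt k b.
  rewrite -(extinction_probE wt1); apply: sumr_ge0 => g _; exact: weight_ge0.
have it0 k : 0 <= iter k (pgf #|C| beta) p'.
  by elim: k => //= k IH; exact: pgf_ge0.
elim: m n => [|m IH] n.
  elim: n => //= n IH; rewrite wt_snd -fp'; apply: pgf_le => //.
  by rewrite ext0.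
case: n => [|n]; first exact: (it0 m.+1).
rewrite [leLHS]/= wt_fst; apply: pgf_le => //.
by rewrite ext0; exact: IH.
Qed.

(** When the original tree survives, some mixed tree survives almost surely:
    the mixed trees die with probabilities tending to [p], the
    probability that the original tree dies.  By [thinned_survival_null]
    the survival of a mixed tree excludes cuts of small cost, which a set
    of measure zero would produce. *)
Lemma tau_positive_measure_ae p p' s' : lambda = 2 `^ (- s') -> 0 < s' ->
  0 <= p < 1 -> pgf #|C| beta p = p -> 0 <= p' < 1 -> pgf #|C| beta' p' = p' ->
  {ae P, forall w, tau beta t w <> set0 ->
     forall s, 0 <= s <= s' -> hausdorff_measure s (tau beta t w) <> 0%E}.
Proof.
move=> lE s'0 hp fp hp' fp'; case/andP: lambda01 => l0 l1.
have hb : 0 < beta <= 1 by rewrite beta_gt0 beta_le1.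
have extp : P (extinction Z whole) = p%:E.
  rewrite -tau_eq0_extinction; apply: (tau_empty_probability _).2.
  by apply: cvg_iter_pgf => //; rewrite lexx ltr01.
have whole_mixed m : extinction Z whole `<=` extinction Z (mixed m).
  move=> w [n _ /= hn]; exists n => //=; apply: contra hn.
  by apply: alive_sub => j k; rewrite /mixed /whole; case: ifP => // _ /andP[].
pose rho m j : R := if (j < m)%N then 1 else lambda.
have rho0 m j : 0 <= rho m j by rewrite /rho; case: ifP => // _; exact: ltW.
have thin m : P.-negligible [set w |
    (forall n, alive (mixed m) (conf_of n (Z^~ w))) /\
    forall e, 0 < e ->
      exists n, cut_cost (rho m) (conf_of n (fun p => (Z p w).1)) < e].
  apply: (thinned_survival_null wt0 wt1 mZ Z_indep (a := fst)) => //.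
    by move=> j k; rewrite /mixed; case: ifP => // _ /andP[].
  move=> j; rewrite /mixed /rho; case: ifP => _; first by rewrite mul1r.
  by rewrite wt_fst wt_snd mulrC.
(* Survival of the original tree and death of all the mixed trees. *)
have gap : P.-negligible
    (\bigcap_m (extinction Z (mixed m) `\` extinction Z whole)).
  apply: negligible_small => e e0.
  have := @cvg_iter_pgf _ _ _ _ p' C_gt1 hb hp fp hp'.
  move=> /cvgrPdist_le/(_ _ e0)[m _ /(_ m (leqnn m))/= hm].
  have mW := measurable_extinction mZ whole.
  have mM := measurable_extinction mZ (mixed m).
  exists (extinction Z (mixed m) `\` extinction Z whole); split.
  - exact: measurableD.
  - by move=> w /(_ m I).
  - rewrite measureD//; last first.
      by rewrite (le_lt_trans (probability_le1 _ _))// ltry.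
    rewrite (setIidr (whole_mixed m)) [X in (_ - X)%E]extp.
    rewrite leeBlDr//; apply: le_trans.
      apply: (extinction_le wt1 mZ Z_indep) => n.
      by apply: (extinction_prob_mixed _ _ _ fp'); case/andP: hp'.
    rewrite -EFinD lee_fin; move: hm; rewrite distrC ler_norml; lra.
have ae1 : {ae P, forall w, forall m,
    ~ ((forall n, alive (mixed m) (conf_of n (Z^~ w))) /\
    forall e, 0 < e ->
      exists n, cut_cost (rho m) (conf_of n (fun p => (Z p w).1)) < e)}.
  apply: ae_foralln => m; apply: negligibleS (thin m) => w /= /contrapT; exact.
have ae2 : {ae P, forall w,
    ~ (\bigcap_m (extinction Z (mixed m) `\` extinction Z whole)) w}.
  apply: negligibleS gap => w /= /contrapT; exact.
apply: filterS2 ae1 ae2 => w h1 h2 tau_n0 s ss' null.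
have nW : ~ extinction Z whole w.
  by rewrite -tau_eq0_extinction.
apply: h2 => m _; split => //; apply: contrapT => nM.
apply: (h1 m); split; first exact: not_extinction.
move=> e e0; have lm0 : 0 < lambda ^+ m by rewrite exprn_gt0.
apply: (@cut_cost_small_of_null R d (retained beta t w) (tau beta t w) (rho m)
  s s' (lambda ^+ m)^-1 e) => //.
- by move=> f of_ y fy; exact: branch_in_tau of_ fy.
- by rewrite invr_gt0.
move=> n; rewrite -lE mulrC ler_pdivlMr//.
have -> : \prod_(j < n) rho m j = lambda ^+ (n - m).
  elim: n => [|n IH]; first by rewrite big_ord0.
  rewrite big_ord_recr/= IH /rho; case: ltnP => nm.
    by rewrite mulr1 (eqP (nm : n.+1 - m == 0)%N)
      (eqP (ltnW nm : n - m == 0)%N).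
  by rewrite subSn// exprSr.
by rewrite -exprD ler_wiXn2l ?(ltW l0)// addnC -leq_subLR.
Qed.

End Thinning.

Lemma tau_subcritical_ae : gamma <= 0 ->
  {ae P, forall w, tau beta t w = set0}.
Proof.
move=> g0.
have mean1 : beta * #|C|%:R <= 1.
  rewrite mulrC offspring_mean -[leRHS](powRr0 (2 : R)).
  by apply: ler_powR => //; rewrite ler1n.
have hb : 0 < beta <= 1 by rewrite beta_gt0 beta_le1.
have [mE PE] := tau_empty_probability 1
  (cvg_iter_pgf_subcritical C_gt1 hb mean1).
exists (~` [set w | tau beta t w = set0]); split => //.
  exact: measurableC.
by rewrite probability_setC// PE subee.
Qed.

(** Both exponent bounds hold almost surely for countably many exponents
    converging to [gamma], which determine the dimension. *)
Lemma tau_supercritical : 0 < gamma ->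
  exists p : R,
     [/\ unique (fun q : R => 0 <= q < 1 /\
                              q = ((1 - beta) + beta * q) ^+ (2 ^ d)%N) p,
         has_probability P [set w | hausdorff_dim (tau beta t w) = gamma%:E]
           (1 - p)
       & has_probability P [set w | tau beta t w = set0] p].
Proof.
move=> g0.
have hb : 0 < beta <= 1 by rewrite beta_gt0 beta_le1.
have supercritical (s : R) : s < gamma -> 1 < beta * 2 `^ (- s) * #|C|%:R.
  move=> sg; rewrite mulrAC [beta * _]mulrC offspring_mean.
  rewrite -powRD ?pnatr_eq0 ?implybT// -[gamma - s]opprK powRN.
  by rewrite invf_gt1 ?powR_gt0// powR2N_lt1// subr_gt0.
have mean1 : 1 < beta * #|C|%:R.
  by have := supercritical 0 g0; rewrite oppr0 powRr0 mulr1.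
have [p hp fp] := pgf_fixed_exists hb mean1.
have h0 : 0 <= (0 : R) < 1 by rewrite lexx ltr01.
have [mE PE] := tau_empty_probability 1 (cvg_iter_pgf C_gt1 hb hp fp h0).
exists p; split.
- split; first by rewrite -card_C.
  move=> q [hq]; rewrite -card_C => /esym fq.
  exact: (pgf_fixed_uniq C_gt1 hb).
- exists (~` [set w | tau beta t w = set0]); split; first exact: measurableC.
    by rewrite probability_setC// PE.
  pose s' k : R := gamma * (1 - k.+2%:R^-1).
  have s'g k : 0 < s' k < gamma.
    have k0 : 0 < k.+2%:R^-1 :> R by rewrite invr_gt0.
    have k1 : k.+2%:R^-1 < 1 :> R by rewrite invf_lt1// ltr1n.
    by rewrite /s' mulr_gt0 ?subr_gt0//= gtr_pMr// gtrBl.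
  have lower : {ae P, forall w, forall k, tau beta t w <> set0 ->
      forall s, 0 <= s <= s' k -> hausdorff_measure s (tau beta t w) <> 0%E}.
    apply: ae_foralln => k; have /andP[s'0 s'1] := s'g k.
    have l01 : 0 < (2 `^ (- s' k) : R) <= 1.
      by rewrite powR_gt0//= ltW// powR2N_lt1.
    have hb' : 0 < beta * 2 `^ (- s' k) <= 1.
      case/andP: l01 => l0 l1; rewrite mulr_gt0//=.
      by apply: mulr_ile1 => //; exact: ltW.
    have [p' hp' fp'] := pgf_fixed_exists hb' (supercritical _ s'1).
    exact: (tau_positive_measure_ae l01 erefl s'0 hp fp hp' fp').
  have upper : {ae P, forall w, forall k,
      hausdorff_measure (gamma + k.+1%:R^-1) (tau beta t w) = 0%E}.
    apply: ae_foralln => k.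
    have k0 : 0 < k.+1%:R^-1 :> R by rewrite invr_gt0.
    have s0 : 0 < gamma + k.+1%:R^-1 by rewrite addr_gt0.
    apply: (@hausdorff_measure_tau_eq0_ae
      (2 `^ (- (gamma + k.+1%:R^-1)))) => //.
    - by rewrite powR_gt0//= ltW// powR2N_lt1.
    - exact: ltW.
    - by rewrite ltrDl.
  have small (e : R) : 0 < e -> exists k : nat, k.+1%:R^-1 < e.
    move=> e0; exists (Num.truncn e^-1); rewrite invf_plt ?posrE//.
    exact: truncnS_gt.
  apply: negligibleS (_ : P.-negligible (~` [set w |
    tau beta t w <> set0 -> hausdorff_dim (tau beta t w) = gamma%:E])).
    move=> w [[/= dimg /contrapT tau0]|[/= ntau ndim] h]; last exact/ndim/h.
    move: dimg; rewrite tau0 hausdorff_dim0 => -[g00].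
    by move: g0; rewrite -g00 ltxx.
  apply: filterS2 lower upper => w lo up tau_n0; apply: hausdorff_dim_eq => //.
    move=> e /small[k hk]; exists (gamma + k.+1%:R^-1) => //.
    by rewrite lerDl invr_ge0 ler0n/= lerD2l ltW.
  move=> s /andP[s0 sg]; have [|k hk] := small ((gamma - s) / gamma).
    by rewrite divr_gt0// subr_gt0.
  apply: (lo k tau_n0); rewrite s0 /s' mulrBr mulr1 lerBrDr -lerBrDl.
  rewrite mulrC -ler_pdivlMr//; apply: le_trans (ltW hk).
  by rewrite lef_pV2 ?posrE// ler_nat.
- exists [set w | tau beta t w = set0]; split => //.
  by rewrite setYK; exact: negligible_set0.
Qed.

End FractalPercolation.

Theorem theorem4 (R : realType) (disp : measure_display)
    (Omega : measurableType disp) (P : probability Omega R)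
    (d : nat) (gamma beta : R) (t : nat -> 'rV[int]_d -> {RV P >-> R}) :
  (1 <= d)%N ->
  gamma <= d%:R ->
  beta = 2 `^ (gamma - d%:R) ->
  independent_RVs (fun n : nat * 'rV[int]_d => t n.1 n.2) ->
  (forall j k, uniform01 (t j k)) ->
  (gamma <= 0 -> {ae P, forall w, tau beta t w = set0}) /\
  (0 < gamma ->
   exists p : R,
     [/\ unique (fun q : R => 0 <= q < 1 /\
                              q = ((1 - beta) + beta * q) ^+ (2 ^ d)%N) p,
         has_probability P [set w | hausdorff_dim (tau beta t w) = gamma%:E]
           (1 - p)
       & has_probability P [set w | tau beta t w = set0] p]).
Proof.
move=> d0 gd bE indt unift; split; first exact: tau_subcritical_ae.
exact: tau_supercritical.
Qed.
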